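(* Let $W$ be a Coxeter group with simple generators $S$ and let $\Omega$ be an orientation of its Coxeter diagram $\Gamma$. The map $\pi_\downarrow^{\Omega}:W\to W$ is order-preserving with respect to the weak order.
   Context: $W$ is a Coxeter group with finite set $S$ of simple generators; $\ell$ is the length function and $e$ the identity. The (right) weak order on $W$ sets $u\le w$ if and only if $\ell(u)+\ell(u^{-1}w)=\ell(w)$. For $J\subseteq S$, $W_J$ is the standard parabolic subgroup generated by $J$. The Coxeter diagram $\Gamma$ is the graph with vertex set $S$ in which distinct $s,t$ are joined by an edge if and only if they do not commute. $\Omega$ is an arbitrary orientation of $\Gamma$ (each edge is given one direction; directed cycles are allowed). A subset $J\subseteq S$ is $\Omega$-acyclic if the induced subgraph of $\Gamma$ on $J$, oriented by $\Omega$, has no directed cycle. For $\Omega$-acyclic $J$, $c(\Omega,J)=s_1s_2\cdots s_k$, where $s_1,\ldots,s_k$ is any ordering of $J$ such that $i<j$ whenever there is an edge oriented $s_j\to s_i$ (the product does not depend on the ordering; $c(\Omega,\emptyset)=e$). $J(w,\Omega)$ denotes the unique maximal (under inclusion) element among the $\Omega$-acyclic subsets $J'\subseteq S$ with $w\ge c(\Omega,J')$ (it is a fact that there is a unique maximal one, which therefore contains all the others). For $w\in W$, $\mathrm{inv}(w)$ is the set of reflections $t$ (conjugates of elements of $S$) with $\ell(tw)<\ell(w)$. For $J\subseteq S$, $w_J$ is the unique element of $W_J$ with $\mathrm{inv}(w_J)=\mathrm{inv}(w)\cap W_J$. The map $\pi_\downarrow^\Omega:W\to W$ is defined recursively by $\pi_\downarrow^\Omega(e)=e$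 and, for $w\neq e$, with $J=J(w,\Omega)$, $\pi_\downarrow^{\Omega}(w)=c(\Omega,J)\,\pi_\downarrow^{\Omega}\bigl(c(\Omega,J)^{-1}w_J\bigr)$. *)

(* Defs.v *)
From HB Require Import structures.
From mathcomp Require Import all_boot.
From mathcomp Require Import boolp classical_sets.

Set Implicit Arguments.
Unset Strict Implicit.
Unset Printing Implicit Defensive.

Local Open Scope group_scope.

(* Equality of words in the group < S | (s t)^(m s t) = 1 >, where m s t = 0
   encodes an infinite exponent (the relator is then the empty word).  As
   m s s = 1 gives s^2 = 1, no formal inverses of letters are needed. *)
Inductive cox_eq (S : finType) (m : S -> S -> nat) : seq S -> seq S -> Prop :=
| cox_eq_relator (a b : seq S) (s t : S) :
    cox_eq m (a ++ flatten (nseq (m s t) [:: s; t]) ++ b) (a ++ b)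
| cox_eq_refl (a : seq S) : cox_eq m a a
| cox_eq_sym (a b : seq S) : cox_eq m a b -> cox_eq m b a
| cox_eq_trans (a b c : seq S) : cox_eq m a b -> cox_eq m b c -> cox_eq m a c.

Record coxeter_system (W : groupType) (S : finType) := CoxeterSystem {
  gen : S -> W;
  cox_mx : S -> S -> nat;
  cox_mx_diag : forall s : S, cox_mx s s = 1%N;
  cox_mx_sym : forall s t : S, cox_mx s t = cox_mx t s;
  cox_mx_neq1 : forall s t : S, s != t -> cox_mx s t != 1%N;
  gen_surj : forall w : W, exists a : seq S, w = \prod_(s <- a) gen s;
  gen_eq : forall a b : seq S,
    \prod_(s <- a) gen s = \prod_(s <- b) gen s <-> cox_eq cox_mx a b
}.

Section Coxeter.

Variables (W : groupType) (S : finType) (C : coxeter_system W S).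

Definition wordprod (a : seq S) : W := \prod_(s <- a) gen C s.

Definition has_word (w : W) (n : nat) : bool :=
  [exists a : n.-tuple S, w == wordprod a].

Fact has_word_ex (w : W) : exists n, has_word w n.
Proof.
have [a ->] := gen_surj C w.
by exists (size a); apply/existsP; exists (in_tuple a); apply/eqP.
Qed.

Definition cox_length (w : W) : nat := ex_minn (has_word_ex w).

Definition weak_le (u w : W) : Prop :=
  (cox_length u + cox_length (u^-1 * w) = cox_length w)%N.

(* The generators being involutions, words in J make up the whole subgroup. *)
Definition parabolic (J : {set S}) : set W :=
  [set w | exists2 a : seq S, {subset a <= J} & w = wordprod a]%classic.

Definition reflection (t : W) : Prop :=
  exists (x : W) (s : S), t = x * gen C s * x^-1.

Definition inversions (w : W) : set W :=
  [set t | reflection t /\ (cox_length (t * w) < cox_length w)%N]%classic.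

(* w_J.  The first argument of xget, here and in c_of and Jmax, is a default
   value for the case where no object satisfies the description; one always
   exists here, in Jmax, and in c_of for acyclic J. *)
Definition par_part (J : {set S}) (w : W) : W :=
  xget 1 [set v | parabolic J v /\
                  inversions v = inversions w `&` parabolic J]%classic.

Definition edge (s t : S) : bool :=
  (s != t) && (gen C s * gen C t != gen C t * gen C s).

(* Omega s t: there is an edge directed from s to t. *)
Definition orientation (Omega : rel S) : Prop :=
  (forall s t, Omega s t -> edge s t) /\
  (forall s t, edge s t -> Omega s t (+) Omega t s).

Variable Omega : rel S.

Definition acyclic (J : {set S}) : Prop :=
  forall p : seq S, p != [::] -> {subset p <= J} -> ~ ucycle Omega p.

Definition c_ordering (J : {set S}) (a : seq S) : Prop :=
  [/\ uniq a, a =i J &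
      {in a &, forall x y, Omega x y -> (index y a < index x a)%N}].

Definition c_of (J : {set S}) : W :=
  wordprod (xget [::] [set a | c_ordering J a]%classic).

Definition Jcandidate (w : W) (J : {set S}) : Prop :=
  acyclic J /\ weak_le (c_of J) w.

Definition Jmax (w : W) : {set S} :=
  xget finset.set0
    [set J | Jcandidate w J /\
       forall J', Jcandidate w J' -> J \subset J' -> J' = J]%classic.

Definition pi_next (w : W) : W := (c_of (Jmax w))^-1 * par_part (Jmax w) w.

Fixpoint pi_iter (n : nat) (w : W) : W :=
  if n is n'.+1 then
    if w == 1 then 1 else c_of (Jmax w) * pi_iter n' (pi_next w)
  else 1.

(* The recursion cut off after cox_length w steps.  For w != 1 the set Jmax w
   contains every s with s <= w, hence is nonempty, and c_of (Jmax w) is below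
   par_part (Jmax w) w; so pi_next w is shorter than w and the cut-off is never
   active: the recursive equations are pi_down1 and pi_downE. *)
Definition pi_down (w : W) : W := pi_iter (cox_length w) w.

Lemma pi_down1 : pi_down 1 = 1.
Proof. by rewrite /pi_down; case: cox_length => //= n; rewrite eqxx. Qed.

Lemma cox_length_eq0 (w : W) : cox_length w = 0 -> w = 1.
Proof.
rewrite /cox_length; case: ex_minnP => n /existsP[a /eqP ->] _ n0; subst n.
by rewrite tuple0 /wordprod big_nil.
Qed.

Lemma pi_downE :
  (forall v : W, v != 1 -> (cox_length (pi_next v) < cox_length v)%N) ->
  forall w : W, w != 1 -> pi_down w = c_of (Jmax w) * pi_down (pi_next w).
Proof.
move=> dec.
have stable n : forall v, (cox_length v <= n)%N -> pi_iter n v = pi_down v.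
  elim/ltn_ind: n => -[|n] IH v /=.
    by rewrite leqn0 => /eqP /cox_length_eq0 ->; rewrite pi_down1.
  case: eqVneq => [-> _|v1 len]; first by rewrite pi_down1.
  rewrite /pi_down; case E: (cox_length v) len => [|k] len /=.
    by rewrite (cox_length_eq0 E) eqxx in v1.
  have lt_k : (cox_length (pi_next v) <= k)%N by rewrite -ltnS -E dec.
  rewrite (negPf v1) IH //; last exact: leq_trans lt_k len.
  by rewrite IH.
move=> w w1; rewrite {1}/pi_down; case E: (cox_length w) => [|k] /=.
  by rewrite (cox_length_eq0 E) eqxx in w1.
by rewrite (negPf w1) stable // -ltnS -E dec.
Qed.

End Coxeter.

(* Main.v *)
From Stdlib Require Import Reals.
From HB Require Import structures.
From mathcomp Require Import all_boot all_order all_algebra.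
From mathcomp Require Import boolp Rstruct ring lra zify.
Require Import Defs.

Set Implicit Arguments.
Unset Strict Implicit.
Unset Printing Implicit Defensive.

Import Order.TTheory GRing.Theory Num.Theory.
Local Open Scope ring_scope.

(* In the reflection representation, u <= w means that the positive roots made
   negative by u^-1 are also made negative by w^-1.

   If Omega is acyclic on J, list J as a word a for c(Omega, J).  Then pi_down is
   computed letter by letter (csort): with s the first letter, take s and rotate
   it to the end if s <= w, drop it otherwise.  By induction, monotonicity reduces
   to a cover w = s u with s not below u, where it follows if z^-1 (al s) is a
   simple root for the image z of u under the rotated word.  Every run of csort
   produces a basis of the root space, made positive by w^-1.  Its dual basis for
   the Euler form is sign-coherent enough for al s to be a nonnegative combination
   of the basis; as u^-1 (al s) is simple, al s is then in the basis, and since s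
   is last, the skew-symmetrized Euler form shows that z^-1 (al s) is simple.

   For arbitrary Omega, the candidates for J(w, Omega) are closed under union: a
   directed cycle in the union would give two roots inverted by w with inner
   product at most -2 (simple roots having square length 2), which is impossible.
   So the same word, for J(w, Omega), computes pi_down of w and of all u <= w. *)

(** * The reflection representation *)

(** The group is known only through its presentation, so descents, reducedness and the weak order
    all have to be recovered from signs of roots. These signs are governed by a Chebyshev recursion;
    the constants [kap] are therefore taken in an arbitrary real field, and cosines appear only at
    the very end.

    The obstacle to a letter-by-letter induction is a cover w = s u at which u drops s and w takes
    it: the runs continue with different words, and csort a u has to be compared with s z, where z =
    csort (rcons a s) u. Idempotence of sorting and the induction hypothesis give csort a u <= z,
    but left multiplication by s need not raise an element in the right weak order. It does when
    z^-1 (al s) is a simple root al q, for then s z = z q. Sorting replaces u by z, and the frame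
    records enough of the run to carry the simplicity of u^-1 (al s) over to z^-1 (al s). *)

Section ReflectionRepresentation.

Variables (R : realFieldType) (kap : nat -> R).
Variables (W : groupType) (S : finType) (C : coxeter_system W S).
Local Notation m := (cox_mx C).
Local Notation gn := (gen C).
Local Notation wp := (wordprod C).
Local Notation len := (cox_length C).
Local Notation V := {ffun S -> R^o}.

(** * Chebyshev values and the Cartan matrix *)

Fixpoint cheb (c : R) (k : nat) : R :=
  match k with
  | 0 => 0
  | 1 => 1
  | (k'.+1 as k1).+1 => c * cheb c k1 - cheb c k'
  end.

Lemma chebSS c k : cheb c k.+2 = c * cheb c k.+1 - cheb c k.
Proof. by []. Qed.

(** [cheb c k] is a Chebyshev polynomial of the second kind, equal to sin (k x) / sin x for c = 2
    cos x. Of c = 2 cos (pi / n) only the signs up to the first zero n are kept; an infinite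
    exponent, coded by 0, gets c = 2. *)
Definition cox_constants : Prop :=
  kap 0 = 2 /\
  forall n, (1 < n)%N ->
    cheb (kap n) n = 0 /\ forall k, (0 < k < n)%N -> 0 < cheb (kap n) k.

Hypothesis kapP : cox_constants.

Definition cartan s t : R := if s == t then 2 else - kap (m s t).
Definition al (s : S) : V := [ffun t => (t == s)%:R].
Definition pair s (x : V) : R := \sum_t cartan s t * x t.
Definition refl s (x : V) : V := x - pair s x *: al s.
Definition bil (x y : V) : R := \sum_s x s * pair s y.

Lemma cartan_diag s : cartan s s = 2.
Proof. by rewrite /cartan eqxx. Qed.

Lemma cartan_sym s t : cartan s t = cartan t s.
Proof. by rewrite /cartan eq_sym cox_mx_sym. Qed.

Lemma cheb_prev c n k : cheb c n = 0 -> cheb c (n + k) = cheb c n.+1 * cheb c k.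
Proof.
move=> cn; elim/ltn_ind: k => -[|[|k]] IH.
- by rewrite addn0 cn mulr0.
- by rewrite addn1 mulr1.
- by rewrite !addnS chebSS -addnS !IH //= ?chebSS; ring.
Qed.

(** The Casoratian of the recursion is constant. At a zero n of [cheb c] it forces [cheb c n.+1] to
    have square 1, whence the period in [cheb_period]. *)
Lemma cheb_det c k : cheb c k.+1 ^+ 2 - cheb c k * cheb c k.+2 = 1.
Proof.
elim: k => [|k IH]; first by rewrite /=; ring.
by rewrite -IH (chebSS c k.+1) (chebSS c k); ring.
Qed.

Lemma cheb_period c n : (0 < n)%N -> cheb c n = 0 ->
  cheb c n.*2 = 0 /\ cheb c n.*2.+1 = 1.
Proof.
case: n => // n _ cn.
have h : cheb c n.+2 ^+ 2 = 1.
  have := cheb_det c n; have := cheb_det c n.+1.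
  rewrite cn => h1 h2; move: h1 h2.
  by rewrite !mul0r subr0.
rewrite -addnn -addnS !cheb_prev // cn mulr0; split=> //.
Qed.

Lemma cheb2 k : cheb 2 k = k%:R.
Proof.
elim/ltn_ind: k => -[|[|k]] IH //.
by rewrite chebSS !IH // -(natr1 k.+1) -(natr1 k); ring.
Qed.

Lemma kap_ge0 n : n != 1%N -> 0 <= kap n.
Proof.
case: n => [|[//|[|n]]] _; first by rewrite kapP.1.
  by have [/= + _] := kapP.2 2%N isT; lra.
have [_ /(_ 2%N isT) /=] := kapP.2 n.+3 isT.
by lra.
Qed.

Lemma kap2 : kap 2 = 0.
Proof. by have [/= + _] := kapP.2 2%N isT; lra. Qed.

Lemma kap_ge1 n : (n == 0)%N || (2 < n)%N -> 1 <= kap n.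
Proof.
case: n => [|[//|[//|[|n]]]] _; first by rewrite kapP.1; lra.
  have [/= h /(_ 2%N isT) /=] := kapP.2 3%N isT.
  by move=> k0; nra.
have [_ h] := kapP.2 n.+4 isT.
move: (h 2%N isT) (h 3%N isT) => /= k0 k1.
by nra.
Qed.

Lemma cartan_le0 s t : s != t -> cartan s t <= 0.
Proof.
by move=> st; rewrite /cartan (negPf st) oppr_le0 kap_ge0 // cox_mx_neq1.
Qed.

(** For exponents at least 3, [cheb c 3 = c ^+ 2 - 1] is nonnegative and c is positive, so c >= 1.
    The gap later keeps root coefficients at 0 or at least 1 in the argument on directed cycles. *)
Lemma cartan_gap s t : s != t -> cartan s t = 0 \/ cartan s t <= -1.
Proof.
move=> st; rewrite /cartan (negPf st); have := cox_mx_neq1 C st.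
case E: (m s t) => [|[|[|k]]] // _; last by right; rewrite lerN2 kap_ge1.
  by right; rewrite lerN2 kap_ge1.
by left; rewrite kap2 oppr0.
Qed.

Lemma cartan_eq0 s t : s != t -> cartan s t = 0 -> m s t = 2.
Proof.
move=> st; rewrite /cartan (negPf st); have := cox_mx_neq1 C st.
case E: (m s t) => [|[|[|k]]] // _ /eqP; rewrite oppr_eq0 => /eqP h.
  by have := @kap_ge1 0 isT; rewrite h ler10.
by have := @kap_ge1 k.+3 isT; rewrite h ler10.
Qed.

(** * Simple reflections and the invariant form *)

Fact pair_is_linear s : linear (pair s : V -> R^o).
Proof.
move=> a x y; rewrite /pair scaler_sumr -big_split /=.
by apply: eq_bigr => t _; rewrite !ffunE /GRing.scale /=; ring.
Qed.
HB.instance Definition _ s :=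
  GRing.isLinear.Build R V R^o *:%R (pair s : V -> R^o) (pair_is_linear s).

Lemma pairZ s a x : pair s (a *: x) = a * pair s x.
Proof. exact: linearZ. Qed.
Lemma pairD s x y : pair s (x + y) = pair s x + pair s y.
Proof. exact: linearD. Qed.
Lemma pairB s x y : pair s (x - y) = pair s x - pair s y.
Proof. exact: linearB. Qed.

Fact refl_is_linear s : linear (refl s).
Proof.
move=> a x y; rewrite /refl linearP /= scalerDl scalerBr scalerA.
by rewrite opprD addrACA.
Qed.
HB.instance Definition _ s :=
  GRing.isLinear.Build R V V *:%R (refl s) (refl_is_linear s).

Lemma oppE (x : V) t : (- x) t = - x t.
Proof. by rewrite ffunE. Qed.
Lemma addE (x y : V) t : (x + y) t = x t + y t.
Proof. by rewrite ffunE. Qed.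
Lemma scaleE a (x : V) t : (a *: x) t = a * x t.
Proof. by rewrite ffunE. Qed.
Lemma alE s t : al s t = (t == s)%:R.
Proof. by rewrite ffunE. Qed.

Lemma pair_al s t : pair s (al t) = cartan s t.
Proof.
rewrite /pair (bigD1 t) //= big1 ?addr0 => [|i /negPf it];
  rewrite ffunE ?eqxx ?mulr1 //.
by rewrite it mulr0.
Qed.

Lemma reflE s x t : refl s x t = x t - (if t == s then pair s x else 0).
Proof.
by rewrite !ffunE /GRing.scale /=; case: eqP => _; rewrite ?mulr1 ?mulr0.
Qed.

Lemma refl_neq s x t : t != s -> refl s x t = x t.
Proof. by move=> /negPf ts; rewrite reflE ts subr0. Qed.

Lemma refl_al s : refl s (al s) = - al s.
Proof. by rewrite /refl pair_al cartan_diag scaler_nat mulr2n opprD addrA subrr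
  sub0r. Qed.

Lemma reflK s : involutive (refl s).
Proof.
move=> x; rewrite {2}/refl linearB linearZ /= refl_al /refl.
by rewrite scalerN opprK addrNK.
Qed.

Lemma vec_sum (x : V) : x = \sum_t x t *: al t.
Proof.
apply/ffunP => i; rewrite sum_ffunE (bigD1 i) //= big1 ?addr0.
  by rewrite !ffunE eqxx /GRing.scale /= mulr1.
by move=> j /negPf ji; rewrite !ffunE eq_sym ji /GRing.scale /= mulr0.
Qed.

Lemma bilDl x x' y : bil (x + x') y = bil x y + bil x' y.
Proof. by rewrite /bil -big_split; apply: eq_bigr => s _ /=;
  rewrite !ffunE mulrDl. Qed.
Lemma bilZl a x y : bil (a *: x) y = a * bil x y.
Proof. by rewrite /bil mulr_sumr; apply: eq_bigr => s _ /=;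
  rewrite !ffunE mulrA. Qed.
Lemma bilC x y : bil x y = bil y x.
Proof.
rewrite /bil /pair (eq_bigr (fun s => \sum_t x s * (cartan s t * y t))); last first.
  by move=> s _; rewrite mulr_sumr.
rewrite exchange_big /=; apply: eq_bigr => t _; rewrite mulr_sumr.
by apply: eq_bigr => s _; rewrite cartan_sym; ring.
Qed.
Lemma bilBl x x' y : bil (x - x') y = bil x y - bil x' y.
Proof. by rewrite -scaleN1r bilDl bilZl mulN1r. Qed.
Lemma bil_al s y : bil (al s) y = pair s y.
Proof.
rewrite /bil (bigD1 s) //= big1 ?addr0 => [|i /negPf it];
  rewrite ffunE ?eqxx ?mul1r //.
by rewrite it mul0r.
Qed.
Lemma bilBr x y y' : bil x (y - y') = bil x y - bil x y'.
Proof. by rewrite bilC bilBl !(bilC x). Qed.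
Lemma bilZr a x y : bil x (a *: y) = a * bil x y.
Proof. by rewrite bilC bilZl bilC. Qed.
Lemma bil_refl s x y : bil (refl s x) (refl s y) = bil x y.
Proof.
rewrite /refl !bilBl !bilBr !bilZl !bilZr !bil_al pair_al cartan_diag.
by rewrite (bilC x (al s)) bil_al; ring.
Qed.

(** * Words, dihedral relations and the action of [W] *)

Definition rho (a : seq S) (x : V) : V := foldr refl x a.

Lemma rho_cat a b x : rho (a ++ b) x = rho a (rho b x).
Proof. by rewrite /rho foldr_cat. Qed.

Fact rho_is_linear a : linear (rho a).
Proof.
elim: a => [|s a IH] k x y //.
by rewrite /rho /= -!/(rho a _) IH linearP.
Qed.
HB.instance Definition _ a :=
  GRing.isLinear.Build R V V *:%R (rho a) (rho_is_linear a).

(* The alternating word is built from its last letter, which is t. *)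
Fixpoint alt (s t : S) (k : nat) : seq S :=
  if k is k'.+1 then (if odd k' then s else t) :: alt s t k' else [::].

Lemma size_alt s t k : size (alt s t k) = k.
Proof. by elim: k => //= k ->. Qed.

Lemma alt_rcons s t k : alt s t k.+1 = rcons (alt t s k) t.
Proof. by elim: k => [|k IH] //=; rewrite -IH /=; case: (odd k). Qed.

Lemma alt_double s t n : alt s t n.*2 = flatten (nseq n [:: s; t]).
Proof. by elim: n => //= n ->; rewrite odd_double. Qed.

Lemma alt_cat s t i j :
  alt s t (i + j) = (if odd j then alt t s i else alt s t i) ++ alt s t j.
Proof.
elim: i => [|i IH]; first by case: odd.
by rewrite addSn /= IH oddD; case: (odd j) => //=; case: (odd i).
Qed.

Lemma refl_plane x y a b :
  refl x (a *: al y + b *: al x) = (- cartan x y * a - b) *: al x + a *: al y.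
Proof.
rewrite /refl pairD !pairZ !pair_al cartan_diag.
by apply/ffunP => i; rewrite !ffunE /GRing.scale /=; ring.
Qed.

Lemma rho_alt s t k : 
  rho (alt s t k) (al s) =
    cheb (- cartan s t) k.+1 *: al (if odd k then t else s) +
    cheb (- cartan s t) k *: al (if odd k then s else t).
Proof.
elim: k => [|k IH]; first by rewrite /= scale1r scale0r addr0.
have -> : rho (alt s t k.+1) (al s) =
   refl (if odd k then s else t) (rho (alt s t k) (al s)) by [].
rewrite IH chebSS /=; case: (odd k) => /=; rewrite refl_plane //.
by rewrite (cartan_sym t s).
Qed.

Lemma rho_alt_double s t n : s != t -> (0 < n)%N -> m s t = n ->
  rho (alt s t n.*2) =1 id.
Proof.
move=> st n0 mst.
have n1 : (1 < n)%N by have := cox_mx_neq1 C st; rewrite mst; lia.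
have cE : - cartan s t = kap n by rewrite /cartan (negPf st) opprK mst.
have [U0 Upos] := kapP.2 n n1.
have [p0 p1] := cheb_period n0 U0.
have fs : rho (alt s t n.*2) (al s) = al s.
  by rewrite rho_alt cE p0 p1 odd_double scale1r scale0r addr0.
have ft : rho (alt s t n.*2) (al t) = al t.
  have [k kE] : exists k, n.*2 = k.+1 by exists n.*2.-1; lia.
  have ok : odd k by have := odd_double n; rewrite kE /=; case: (odd k).
  rewrite kE alt_rcons -cats1 rho_cat /= refl_al linearN /= rho_alt ok
    cartan_sym cE.
  have Uk : cheb (kap n) k = -1.
    by have := chebSS (kap n) k; rewrite -kE p0 p1; lra.
  by rewrite -kE p0 Uk scale0r add0r scaleN1r opprK.
(* At c = 2 the sequence [cheb c k] is k and never returns to 0. The Gram determinant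
   [4 - kap n ^+ 2] of al s and al t is then nonzero. *)
have kap_lt2 : kap n != 2.
  by apply/eqP => k2; move: U0; rewrite k2 cheb2 => /eqP; rewrite pnatr_eq0; lia.
have kap0 : 0 <= kap n by apply: kap_ge0; lia.
have det0 : 4 - kap n ^+ 2 != 0.
  have -> : 4 - kap n ^+ 2 = (2 - kap n) * (2 + kap n) :> R by ring.
  apply: mulf_neq0; first by rewrite subr_eq0 eq_sym.
  by rewrite lt0r_neq0 // ltr_pwDl // ltr0n.
move=> x.
(* The plane of al s and al t is nondegenerate, so x differs from an element
   orthogonal to it by an element of it. *)
pose p := pair s x; pose q := pair t x; pose d := 4 - kap n ^+ 2.
pose a := (2 * p + kap n * q) / d; pose b := (2 * q + kap n * p) / d.
have cE' : cartan s t = - kap n by rewrite -cE opprK.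
pose y := x - (a *: al s + b *: al t).
have ys : pair s y = 0.
  rewrite pairB pairD !pairZ !pair_al cartan_diag cE' -/p /a /b /=.
  by rewrite /d; field.
have yt : pair t y = 0.
  rewrite pairB pairD !pairZ !pair_al cartan_diag cartan_sym cE' -/q /a /b /=.
  by rewrite /d; field.
have fy k : rho (alt s t k) y = y.
  elim: k => //= k; rewrite /rho /= -/(rho _ _) => ->.
  by rewrite /refl; case: (odd k); rewrite ?ys ?yt scale0r subr0.
have -> : x = y + (a *: al s + b *: al t) by rewrite addrNK.
by rewrite linearD /= fy linearD !linearZ /= fs ft.
Qed.

Lemma rho_cox_eq a b : cox_eq m a b -> rho a =1 rho b.
Proof.
elim=> {a b} [a b s t x|//|a b _ IH x|a b c _ IHa _ IHb x]; last 2 first.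
- by rewrite IH.
- by rewrite IHa.
rewrite !rho_cat; congr (rho a _); set y := rho b x.
have [->|st] := eqVneq s t.
  by rewrite cox_mx_diag /= /rho /= reflK.
rewrite -alt_double; case E: (m s t) => [|n] //.
exact: rho_alt_double.
Qed.

Lemma wp_nil : wp [::] = 1%g. Proof. exact: big_nil. Qed.
Lemma wp_cons s a : wp (s :: a) = (gn s * wp a)%g. Proof. exact: big_cons. Qed.
Lemma wp_cat a b : wp (a ++ b) = (wp a * wp b)%g. Proof. exact: big_cat. Qed.
Lemma wp_seq1 s : wp [:: s] = gn s. Proof. by rewrite wp_cons wp_nil mulg1. Qed.
Lemma wp_rcons a s : wp (rcons a s) = (wp a * gn s)%g.
Proof. by rewrite -cats1 wp_cat wp_seq1. Qed.

Lemma gen_sq s : (gn s * gn s = 1)%g.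
Proof.
have := (gen_eq C [:: s; s] [::]).2.
rewrite -/(wp _) -/(wp [::]) wp_cons wp_seq1 wp_nil; apply.
by have := cox_eq_relator m [::] [::] s s; rewrite cox_mx_diag.
Qed.
Lemma genV s : (gn s)^-1%g = gn s.
Proof. by apply: (@mulgI _ (gn s)); rewrite mulgV gen_sq. Qed.
Lemma genK s w : (gn s * (gn s * w) = w)%g.
Proof. by rewrite mulgA gen_sq mul1g. Qed.
Lemma wp_rev a : wp (rev a) = (wp a)^-1%g.
Proof.
elim: a => [|s a IH]; first by rewrite wp_nil invg1.
by rewrite rev_cons wp_rcons wp_cons invgM IH genV.
Qed.

Definition word (w : W) : seq S := sval (cid (gen_surj C w)).
Lemma wordK w : wp (word w) = w.
Proof. by rewrite /word; case: cid => /= a ->. Qed.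

Definition act (w : W) (x : V) : V := rho (word w) x.
Fact act_is_linear w : linear (act w).
Proof. by move=> a x y; rewrite /act linearP. Qed.
HB.instance Definition _ w :=
  GRing.isLinear.Build R V V *:%R (act w) (act_is_linear w).

Lemma act_wp a x : act (wp a) x = rho a x.
Proof. by apply/rho_cox_eq/gen_eq; exact: wordK. Qed.
Lemma act_gen s x : act (gn s) x = refl s x.
Proof. by rewrite -wp_seq1 act_wp. Qed.
Lemma act1 x : act 1%g x = x.
Proof. by rewrite -wp_nil act_wp. Qed.
Lemma actM u w x : act (u * w)%g x = act u (act w x).
Proof. by rewrite -{1}(wordK u) -{1}(wordK w) -wp_cat act_wp rho_cat. Qed.
Lemma actK w x : act w^-1%g (act w x) = x.
Proof. by rewrite -actM mulVg act1. Qed.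
Lemma actKV w x : act w (act w^-1%g x) = x.
Proof. by rewrite -actM mulgV act1. Qed.
Lemma actVM s w x : act (gn s * w)^-1%g x = act w^-1%g (refl s x).
Proof. by rewrite invgM actM genV act_gen. Qed.
Lemma actN w x : act w (- x) = - act w x.
Proof. exact: linearN. Qed.
Lemma actD w x y : act w (x + y) = act w x + act w y.
Proof. exact: linearD. Qed.
Lemma actZ w a x : act w (a *: x) = a *: act w x.
Proof. exact: linearZ. Qed.
Lemma bil_act w x y : bil (act w x) (act w y) = bil x y.
Proof.
rewrite -(wordK w) !act_wp; elim: (word w) => // s a IH.
by rewrite /rho /= bil_refl.
Qed.

(** * Length and descents *)

Lemma len_wp a : (len (wp a) <= size a)%N.
Proof.
rewrite /cox_length; case: ex_minnP => n _; apply; apply/existsP.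
by exists (in_tuple a).
Qed.
Lemma reduced_word w : exists2 a, wp a = w & size a = len w.
Proof.
rewrite /cox_length; case: ex_minnP => n /existsP[a /eqP ->] _.
by exists a; rewrite ?size_tuple.
Qed.
Lemma len1 : len 1%g = 0%N.
Proof. by apply/eqP; rewrite -leqn0 -wp_nil len_wp. Qed.
Lemma lenM u w : (len (u * w)%g <= len u + len w)%N.
Proof.
have [a <- <-] := reduced_word u; have [b <- <-] := reduced_word w.
by rewrite -wp_cat -size_cat len_wp.
Qed.
Lemma lenV w : len w^-1%g = len w.
Proof.
have le v : (len v^-1%g <= len v)%N.
  by have [a <- <-] := reduced_word v; rewrite -wp_rev -(size_rev a) len_wp.
by apply/eqP; rewrite eqn_leq le -{1}(invgK w) le.
Qed.
Lemma len_gen s : (len (gn s) <= 1)%N.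
Proof. by rewrite -wp_seq1 len_wp. Qed.

(** Relators have even length, so parity of words is an invariant of the group element. Hence a
    generator changes the length by exactly one, as [ldescP] needs. *)
Lemma cox_eq_odd a b : cox_eq m a b -> odd (size a) = odd (size b).
Proof.
elim=> {a b} [a b s t|//|a b _ -> //|a b c _ -> _ -> //].
rewrite !size_cat !oddD; suff -> : odd (size (flatten (nseq (m s t) [:: s;
  t]))) = false.
  by [].
by elim: (m s t) => //= n ->.
Qed.
Lemma odd_len a : odd (len (wp a)) = odd (size a).
Proof.
have [b ab <-] := reduced_word (wp a); apply: cox_eq_odd.
exact/gen_eq.
Qed.
Lemma odd_lenM u w : odd (len (u * w)%g) = odd (len u) (+) odd (len w).
Proof. by rewrite -(wordK u) -(wordK w) -wp_cat !odd_len size_cat oddD. Qed.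
Lemma odd_len_gen s : odd (len (gn s)).
Proof. by rewrite -wp_seq1 odd_len. Qed.

Definition ldesc s w := (len (gn s * w)%g < len w)%N.

Lemma ldescP s w : if ldesc s w then len w = (len (gn s * w)%g).+1
  else len (gn s * w)%g = (len w).+1.
Proof.
rewrite /ldesc.
have h1 := lenM (gn s) w; have h2 := lenM (gn s) (gn s * w)%g.
rewrite genK in h2; have g1 := len_gen s.
have := odd_lenM (gn s) w; rewrite odd_len_gen /=.
by case: ltnP => h4 h3; lia.
Qed.
Lemma len_ldesc s w : ldesc s w -> len w = (len (gn s * w)%g).+1.
Proof. by have := ldescP s w; case: ldesc. Qed.
Lemma ldesc_gen s w : ldesc s (gn s * w)%g = ~~ ldesc s w.
Proof. by have := ldescP s w; rewrite {2}/ldesc genK; case: ldesc => /= ->;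
  lia. Qed.

(** * Positivity of roots *)

Definition pos (x : V) : bool := [forall t, 0 <= x t].
Lemma posP (x : V) : reflect (forall t, 0 <= x t) (pos x).
Proof. exact: forallP. Qed.
Lemma pos_al s : pos (al s).
Proof. by apply/posP => t; rewrite ffunE ler0n. Qed.
Lemma posD x y : pos x -> pos y -> pos (x + y).
Proof. by move=> /posP px /posP py; apply/posP => t; rewrite ffunE addr_ge0. Qed.
Lemma posZ a x : 0 <= a -> pos x -> pos (a *: x).
Proof. by move=> a0 /posP px; apply/posP => t; rewrite ffunE mulr_ge0. Qed.
Lemma pos_sum (I : Type) (r : seq I) (P : pred I) (F : I -> V) :
  (forall i, P i -> pos (F i)) -> pos (\sum_(i <- r | P i) F i).
Proof.
move=> h; elim/big_ind: _ => //; last exact: posD.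
by apply/posP => t; rewrite ffunE.
Qed.
Lemma pos_act w (x : V) : (forall t, x t != 0 -> pos (act w (al t))) -> pos x ->
  pos (act w x).
Proof.
move=> h /posP px; rewrite (vec_sum x) linear_sum; apply: pos_sum => t _.
have [->|xt] := eqVneq (x t) 0; first by rewrite scale0r linear0;
  apply/posP => i; rewrite ffunE.
by rewrite linearZ; apply: posZ => //; apply: h.
Qed.

(** The relator word of length 2n is trivial, so its last n + 1 letters multiply to the inverse of
    its first n - 1 letters, which saves two letters. *)
Lemma alt_braid s t n : m s t = n -> (0 < n)%N -> 
  forall k, (n < k)%N -> (len (wp (alt s t k)) + 2 <= k)%N.
Proof.
move=> mst n0 k nk.
have [i iE] : exists i, k = (i + n.+1)%N by exists (k - n.+1)%N; lia.
rewrite iE alt_cat wp_cat; set u := (if _ then _ else _).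
have su : size u = i by rewrite /u; case: ifP; rewrite size_alt.
have h1 := lenM (wp u) (wp (alt s t n.+1)); have h2 := len_wp u.
suff h3 : (len (wp (alt s t n.+1)) <= n.-1)%N by lia.
have w1 : wp (alt s t n.*2) = 1%g.
  rewrite alt_double -mst -wp_nil; apply/gen_eq.
  by have := cox_eq_relator m [::] [::] s t; rewrite cats0.
have nE : n.*2 = (n.-1 + n.+1)%N by lia.
move: w1; rewrite nE alt_cat wp_cat; set v := (if _ then _ else _) => w1.
have -> : wp (alt s t n.+1) = (wp v)^-1%g.
  by apply: (@mulgI _ (wp v)); rewrite w1 mulgV.
by rewrite lenV (leq_trans (len_wp _)) // /v; case: ifP; rewrite size_alt.
Qed.

Lemma rdescP w s : (len (w * gn s)%g < len w)%N = ldesc s w^-1%g.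
Proof. by rewrite /ldesc -(lenV (w * gn s)%g) -(lenV w) invgM genV. Qed.

(** Right descents among s and t are stripped greedily. After t is removed it is no longer a
    descent, so only s can follow, and the stripped word alternates. *)
Lemma dihedral_decomposition w s t : s != t -> ldesc t w^-1%g ->
  exists k v, [/\ (0 < k)%N, w = (v * wp (alt s t k))%g, len w = (len v + k)%N,
    ~~ ldesc s v^-1%g & ~~ ldesc t v^-1%g].
Proof.
move: {2}(len w) (leqnn (len w)) => n; elim: n w s t => [|n IH] w s t lw st tw.
  by move: tw; rewrite /ldesc lenV; lia.
pose v := (w * gn t)%g.
have vV : v^-1%g = (gn t * w^-1)%g by rewrite invgM genV.
have lv : len w = (len v).+1.
  by rewrite -(lenV w) (len_ldesc tw) -vV lenV.
have tv : ~~ ldesc t v^-1%g by rewrite vV ldesc_gen negbK.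
have wE : w = (v * gn t)%g by rewrite /v -mulgA gen_sq mulg1.
have [sv|sv] := boolP (ldesc s v^-1%g); last first.
  by exists 1%N, v; split => //; rewrite ?addn1 //= wp_seq1.
have lvn : (len v <= n)%N by lia.
have ts : t != s by rewrite eq_sym.
have [k [u [k0 vE lE h1 h2]]] := IH v t s lvn ts sv.
exists k.+1, u; split => //.
  by rewrite alt_rcons wp_rcons mulgA -vE.
by rewrite lv lE addnS.
Qed.

Lemma cheb_ge0 n k : (1 < n)%N || (n == 0)%N -> (k <= n)%N || (n == 0)%N -> 0 <=
  cheb (kap n) k.
Proof.
case: n => [|n] /= n1 kn; first by rewrite kapP.1 cheb2 ler0n.
have {}n1 : (1 < n.+1)%N by lia.
have [U0 Up] := kapP.2 _ n1.
case: k kn => [|k] kn; first by [].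
have [->|ne] := eqVneq k n; first by rewrite U0.
by apply/ltW/Up; lia.
Qed.

(* Writing w = v d with d in the dihedral group of s and a right descent t and
   v shortest in its coset, d (al s) is a combination of al s and al t whose
   coefficients are consecutive, hence nonnegative, Chebyshev values. *)
Lemma ascent_pos w s : ~~ ldesc s w^-1%g -> pos (act w (al s)).
Proof.
move: {2}(len w) (leqnn (len w)) => n; elim/ltn_ind: n w s => n IH w s lw sw.
have [w1|w1] := eqVneq w 1%g; first by rewrite w1 act1 pos_al.
have [t tw] : exists t, ldesc t w^-1%g.
  have [a aE sa] := reduced_word w; case/lastP: a aE sa => [|a t] aE sa.
    by rewrite -aE wp_nil eqxx in w1.
  exists t; rewrite -rdescP -sa -aE wp_rcons -mulgA gen_sq mulg1 size_rcons ltnS.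
  exact: len_wp.
have st : s != t by apply: contraNneq sw => ->.
have [k [v [k0 wE lE sv tv]]] := dihedral_decomposition st tw.
have lvn : (len v < n)%N by lia.
have ps : pos (act v (al s)) by apply: (IH (len v)).
have pt : pos (act v (al t)) by apply: (IH (len v)).
have n1 : (1 < m s t)%N || (m s t == 0)%N.
  by have := cox_mx_neq1 C st; case: (m s t) => [|[]].
(* Otherwise appending s would give an alternating word longer than the exponent, and by [alt_braid]
   w s would be shorter than w. The inequality is strict because the coefficient [cheb] at k + 1
   occurs below. *)
have kn : (k < m s t)%N || (m s t == 0)%N.
  case: (posnP (m s t)) => [->|m0]; first by rewrite orbT.
  rewrite orbF ltnNge; apply/negP => mk.
  have h := @alt_braid t s (m s t) (cox_mx_sym C t s) m0 k.+1 mk.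
  have h1 := lenM v (wp (alt t s k.+1)).
  move: sw; rewrite -rdescP -leqNgt wE -mulgA -wp_rcons -alt_rcons -wE => h2.
  by move: (leq_trans h2 h1) h; rewrite lE leq_add2l addn2 ltnS => h3 h4;
    have := leq_ltn_trans h3 h4; rewrite ltnn.
rewrite wE actM act_wp rho_alt linearD !linearZ /=.
have cE : - cartan s t = kap (m s t) by rewrite /cartan (negPf st) opprK.
have kn' : (k <= m s t)%N || (m s t == 0)%N.
  by case/orP: kn => [/ltnW ->|->]; rewrite ?orbT.
rewrite cE; apply: posD; apply: posZ;
  by [exact: (@cheb_ge0 _ k.+1) | exact: cheb_ge0 | case: (odd k)].
Qed.

(** * Roots, inversions and the weak order *)

Definition root (b : V) : Prop := exists w s, b = act w (al s).
Definition inv (w : W) (b : V) : Prop := [/\ root b, pos b & pos (- act w^-1%g b)].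

Lemma root_al s : root (al s).
Proof. by exists 1%g, s; rewrite act1. Qed.
Lemma root_act w b : root b -> root (act w b).
Proof. by case=> v [s ->]; exists (w * v)%g, s; rewrite actM. Qed.
Lemma root_refl s b : root b -> root (refl s b).
Proof. by rewrite -act_gen; apply: root_act. Qed.
Lemma rootN b : root b -> root (- b).
Proof.
by case=> w [s ->]; exists (w * gn s)%g, s; rewrite actM act_gen refl_al actN.
Qed.
Lemma root_norm b : root b -> bil b b = 2.
Proof. by case=> w [s ->]; rewrite bil_act bil_al pair_al cartan_diag. Qed.

Lemma descent_neg s w : ldesc s w -> pos (- act w^-1%g (al s)).
Proof.
move=> sw; have := @ascent_pos (gn s * w)^-1%g s.
by rewrite invgK ldesc_gen sw => /(_ isT); rewrite actVM refl_al actN.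
Qed.
Lemma nondescent_pos s w : ~~ ldesc s w -> pos (act w^-1%g (al s)).
Proof. by move=> sw; apply: ascent_pos; rewrite invgK. Qed.

Lemma root_sign b : root b -> pos b \/ pos (- b).
Proof.
case=> w [s ->]; have [sw|sw] := boolP (ldesc s w^-1%g).
  by right; have := descent_neg sw; rewrite invgK.
by left; have := nondescent_pos sw; rewrite invgK.
Qed.
Lemma pos_asym b : pos b -> pos (- b) -> b = 0.
Proof.
move=> /posP p1 /posP p2; apply/ffunP => t; apply/eqP.
by have := p2 t; rewrite !ffunE oppr_ge0 => p3; rewrite eq_le p3 p1.
Qed.
Lemma root_asym b : root b -> pos b -> pos (- b) -> False.
Proof.
move=> rb p1 p2; have := root_norm rb; rewrite (pos_asym p1 p2) -(scale0r 0)
  bilZl mul0r.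
by move/eqP; rewrite eq_sym pnatr_eq0.
Qed.
Lemma ldescE s w : ldesc s w = pos (- act w^-1%g (al s)).
Proof.
apply/idP/idP; first exact: descent_neg.
move=> p; apply: contraT => /nondescent_pos p'.
by case: (root_asym (root_act _ (root_al s)) p' p).
Qed.
Lemma inv_al s w : ldesc s w -> inv w (al s).
Proof. by rewrite ldescE; split => //; [apply: root_al|apply: pos_al]. Qed.
Lemma ldesc_inv s w : inv w (al s) -> ldesc s w.
Proof. by rewrite ldescE; case. Qed.

Lemma root_supp s (b : V) : root b -> pos b -> (forall t, t != s -> b t = 0) ->
  b = al s.
Proof.
move=> rb pb z; have bE : b = b s *: al s.
  apply/ffunP => t; rewrite !ffunE /GRing.scale /=.
  by have [->|ts] := eqVneq t s; rewrite ?mulr1 // mulr0 z.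
have := root_norm rb; rewrite {1 2}bE bilZl bilZr bil_al pair_al cartan_diag => h.
rewrite bE; suff -> : b s = 1 by rewrite scale1r.
have b0 : 0 <= b s by move/posP: pb => /(_ s).
have : (b s - 1) * (b s + 1) = 0 by lra.
by move/eqP; rewrite mulf_eq0 subr_eq0 => /orP[/eqP //|/eqP]; lra.
Qed.

Lemma refl_pos s b : root b -> pos b -> b != al s -> pos (refl s b).
Proof.
move=> rb pb /eqP ne; case: (root_sign (root_refl s rb)) => // /posP n.
case: ne; apply: root_supp => // t ts; apply/eqP.
have := n t; rewrite oppE refl_neq // oppr_ge0 => le0.
by rewrite eq_le le0; move/posP: pb => /(_ t).
Qed.

Lemma inv_gen s w b : inv w b -> b != al s -> inv (gn s * w)%g (refl s b).
Proof.
case=> rb pb nb ne; split; [exact: root_refl|exact: refl_pos|].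
by rewrite actVM reflK.
Qed.
Lemma inv1 b : ~ inv 1%g b.
Proof. by case=> rb pb; rewrite invg1 act1; apply: root_asym. Qed.

Lemma eq1_or_ldesc w : w = 1%g \/ exists s, ldesc s w.
Proof.
have [a aE sa] := reduced_word w; case: a aE sa => [|s a] aE sa.
  by left; rewrite -aE wp_nil.
right; exists s; rewrite /ldesc -sa -aE wp_cons genK ltnS; exact: len_wp.
Qed.

Lemma weak_ind (P : W -> Prop) : P 1%g ->
  (forall s w, ldesc s w -> P (gn s * w)%g -> P w) -> forall w, P w.
Proof.
move=> P1 PS w; move: {2}(len w) (leqnn (len w)) => n; elim: n w => [|n IH] w lw.
  by have [->//|[s]] := eq1_or_ldesc w; rewrite /ldesc; lia.
have [->//|[s sw]] := eq1_or_ldesc w; apply: (PS s) => //; apply: IH.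
by have := len_ldesc sw; lia.
Qed.

(** The first letter of y is moved to the end of u, which keeps the product reduced; its own simple
    root is positive under u because it is not a right descent of u. *)
Lemma reduced_mul_pos u y g : len (u * y)%g = (len u + len y)%N -> inv y g ->
  pos (act u g).
Proof.
elim/weak_ind: y u g => [|s y sy IH] u g; first by move=> _ /inv1.
move=> luy iy; have lsy := len_ldesc sy.
have uE : (u * y = (u * gn s) * (gn s * y))%g by rewrite -mulgA genK.
have h1 := lenM (u * gn s)%g (gn s * y)%g.
have h2 := lenM u (gn s); have h3 := len_gen s.
rewrite -uE luy lsy in h1.
have lus : len (u * gn s)%g = (len u).+1 by lia.
have su : ~~ ldesc s u^-1%g by rewrite -rdescP lus; lia.
have [gE|ne] := eqVneq g (al s).
  by have := nondescent_pos su; rewrite invgK gE.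
have := IH (u * gn s)%g (refl s g) _ (inv_gen iy ne).
by rewrite actM act_gen reflK; apply; rewrite -uE luy lsy lus addSnnS.
Qed.

Lemma weak_le_inv u w b : weak_le C u w -> inv u b -> inv w b.
Proof.
rewrite /weak_le => le_uw [rb pb nb]; split => //.
have wE : w = (u * (u^-1 * w))%g by rewrite mulgA mulgV mul1g.
have [p|//] := root_sign (root_act w^-1%g rb).
have ly : len (u * (u^-1 * w))%g = (len u + len (u^-1 * w)%g)%N by rewrite -wE.
have iy : inv (u^-1 * w)%g (- act u^-1%g b).
  split=> //; first exact/rootN/root_act.
  by rewrite actN opprK -actM invgM invgK -mulgA mulgV mulg1.
have := reduced_mul_pos ly iy; rewrite actN actKV => nb'.
by case: (root_asym rb pb nb').
Qed.

Lemma inv_weak_le u w : (forall b, inv u b -> inv w b) -> weak_le C u w.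
Proof.
rewrite /weak_le; elim/weak_ind: u w => [|s u su IH] w h.
  by rewrite len1 invg1 mul1g.
have sw : ldesc s w by apply/ldesc_inv/h/inv_al.
rewrite (len_ldesc su) (len_ldesc sw) addSn; congr _.+1.
rewrite -(IH (gn s * w)%g) => [|b [rb pb nb]].
  by rewrite invgM genV -mulgA genK.
have ne : b != al s.
  apply/eqP => bE; move: nb; rewrite bE -ldescE ldesc_gen su; done.
have [_ _] : inv w (refl s b).
  apply: h; split; [exact: root_refl|exact: refl_pos|by rewrite -actVM].
by split => //; rewrite actVM.
Qed.

Lemma weak_le_trans u v w : weak_le C u v -> weak_le C v w -> weak_le C u w.
Proof. by move=> h1 h2; apply: inv_weak_le => b /(weak_le_inv h1)/(weak_le_inv
  h2). Qed.
Lemma weak_le_refl w : weak_le C w w.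
Proof. exact: inv_weak_le. Qed.
Lemma weak_le_len u w : weak_le C u w -> (len u <= len w)%N.
Proof. by move=> <-; apply: leq_addr. Qed.
Lemma weak_le_ldesc s u w : weak_le C u w -> ldesc s u -> ldesc s w.
Proof. by move=> le_uw /inv_al/(weak_le_inv le_uw)/ldesc_inv. Qed.
Lemma weak_le_gen2 s u w : ldesc s u -> ldesc s w ->
  weak_le C (gn s * u)%g (gn s * w)%g <-> weak_le C u w.
Proof.
move=> su sw; rewrite /weak_le (len_ldesc su) (len_ldesc sw) invgM genV -!mulgA
  genK.
by rewrite addSn; split => [->|[]].
Qed.

Lemma act_act_inj w x y : act w x = act w y -> x = y.
Proof. by move=> h; rewrite -(actK w x) h actK. Qed.
Lemma faithful w : (forall x, act w x = x) -> w = 1%g.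
Proof.
move=> h; have [//|[s]] := eq1_or_ldesc w; rewrite ldescE -{1}(h (al s)) actK.
by move/(root_asym (root_al s) (pos_al s)).
Qed.

(** * The Euler form and sorting along a word *)

Definition supp (a : seq S) (x : V) : Prop := forall t, t \notin a -> x t = 0.
Definition rpair s (a : seq S) (x : V) : R := \sum_(t <- a) cartan s t * x t.

(* The Euler form of the Coxeter element wp a. *)
Fixpoint eul (a : seq S) (x y : V) : R :=
  if a is s :: a' then y s * (x s + rpair s a' x) + eul a' x y else 0.

Lemma rpair_cons s t a x : rpair s (t :: a) x = cartan s t * x t + rpair s a x.
Proof. exact: big_cons. Qed.
Lemma rpair_rcons s t a x : rpair s (rcons a t) x = rpair s a x + cartan s t * x t.
Proof. by rewrite /rpair -cats1 big_cat big_seq1. Qed.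
Lemma eq_rpair s (a : seq S) (x y : V) : {in a, x =1 y} -> rpair s a x = rpair s
  a y.
Proof. by move=> h; apply: eq_big_seq => t /h ->. Qed.
Lemma rpair_pair s a x : uniq (s :: a) -> supp (s :: a) x ->
  pair s x = 2 * x s + rpair s a x.
Proof.
move=> ua sx; rewrite -(cartan_diag s) -rpair_cons /rpair big_uniq //= /pair.
rewrite [LHS](bigID (fun t => t \in s :: a)) /= [X in _ + X]big1 ?addr0 // => t ta.
by rewrite sx ?mulr0.
Qed.

Lemma eul_rcons a s x y :
  eul (rcons a s) x y = eul a x y + x s * (y s + rpair s a y).
Proof.
elim: a => [|r a IH] /=; first by rewrite /rpair !big_nil; ring.
by rewrite IH rpair_cons rpair_rcons cartan_sym; ring.
Qed.
Lemma eq_eul (a : seq S) (x x' y y' : V) : {in a, x =1 x'} -> {in a, y =1 y'} ->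
  eul a x y = eul a x' y'.
Proof.
elim: a => //= s a IH hx hy.
have hx' : {in a, x =1 x'} by move=> t ta; apply: hx; rewrite inE ta orbT.
have hy' : {in a, y =1 y'} by move=> t ta; apply: hy; rewrite inE ta orbT.
by rewrite (IH hx' hy') (eq_rpair s hx') hx ?hy ?mem_head.
Qed.

Lemma reflE_in s (a : seq S) x : s \notin a -> {in a, refl s x =1 x}.
Proof. by move=> sa t ta; rewrite refl_neq //; apply: contraNneq sa => <-. Qed.
Lemma refl_diag s a x : uniq (s :: a) -> supp (s :: a) x ->
  refl s x s = - x s - rpair s a x.
Proof. by move=> ua sx; rewrite reflE eqxx (rpair_pair ua sx); ring. Qed.

(** Rotating the first letter to the end is, on the level of classes, a reflection functor; it is an
    isometry between the two Euler forms, which makes frames compatible with taking a letter. *)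
Lemma eul_refl s a x y : uniq (s :: a) -> supp (s :: a) x -> supp (s :: a) y ->
  eul (rcons a s) (refl s x) (refl s y) = eul (s :: a) x y.
Proof.
move=> ua sx sy; have /andP[sa _] := ua.
rewrite eul_rcons /= (eq_eul (reflE_in _ sa) (reflE_in _ sa)).
by rewrite (eq_rpair s (reflE_in _ sa)) !(refl_diag ua) //; ring.
Qed.

Lemma eulPr a x k y z : eul a x (k *: y + z) = k * eul a x y + eul a x z.
Proof.
elim: a => [|s a IH] /=; first by ring.
by rewrite IH addE scaleE; ring.
Qed.
Lemma eul0r a x : eul a x 0 = 0.
Proof. by elim: a => //= s a ->; rewrite ffunE; ring. Qed.
Lemma rpair0 s (a : seq S) (x : V) : {in a, forall t, x t = 0} -> rpair s a x = 0.
Proof. by move=> h; rewrite /rpair big_seq big1 // => t /h ->; rewrite mulr0. Qed.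
Lemma eul0l (a : seq S) (x y : V) : {in a, forall t, x t = 0} -> eul a x y = 0.
Proof.
elim: a => //= s a IH h.
have h' : {in a, forall t, x t = 0} by move=> t ta; apply: h; rewrite inE ta orbT.
by rewrite IH // rpair0 // h ?mem_head //; ring.
Qed.
Lemma eul0r_in (a : seq S) (x y : V) : {in a, forall t, y t = 0} -> eul a x y = 0.
Proof.
move=> h; rewrite -(eul0r a x); apply: eq_eul => // t /h ->.
by rewrite ffunE.
Qed.
Lemma eulNr a x y : eul a x (- y) = - eul a x y.
Proof. by rewrite -[- y]addr0 -scaleN1r eulPr eul0r; ring. Qed.
Lemma al_in s (a : seq S) : s \notin a -> {in a, forall t, al s t = 0}.
Proof. by move=> sa t ta; rewrite alE (negPf (memPn sa t ta)). Qed.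

Lemma rho_notin (a : seq S) x t : t \notin a -> rho a x t = x t.
Proof.
elim: a => //= s a IH; rewrite inE negb_or => /andP[ts ta].
by rewrite /rho /= -/(rho a x) refl_neq // IH.
Qed.
Lemma act_wpV a x : act (wp a)^-1%g x = rho (rev a) x.
Proof. by rewrite -wp_rev act_wp. Qed.
Lemma supp_rho a b x : {subset b <= a} -> supp a x -> supp a (rho b x).
Proof.
move=> ba sx t ta; rewrite rho_notin ?sx //.
by apply: contraNN ta; apply: ba.
Qed.
Lemma supp_refl a s x : s \in a -> supp a x -> supp a (refl s x).
Proof. by move=> sa; apply: (@supp_rho a [:: s]) => t; rewrite inE => /eqP ->. Qed.
Lemma sub_supp a b x : {subset a <= b} -> supp a x -> supp b x.
Proof. by move=> ab sx t tb; apply: sx; apply: contraNN tb; apply: ab. Qed.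
Lemma supp_al s a : s \in a -> supp a (al s).
Proof. by move=> sa t ta; rewrite alE; case: eqP ta => // ->; rewrite sa. Qed.

Lemma eul_coxeterV a s x : uniq a -> s \notin a ->
  eul a x (act (wp a)^-1%g (al s)) = - rpair s a x.
Proof.
elim: a s => [|r a IH] s; first by rewrite /= /rpair big_nil oppr0.
rewrite inE negb_or => /= /andP[ra ua] /andP[sr sa].
rewrite wp_cons actVM.
set v := act _ _.
have vE : v = (- cartan r s) *: act (wp a)^-1%g (al r) + act (wp a)^-1%g (al s).
  by rewrite /v /refl pair_al actD actN actZ scaleNr addrC.
have vr : v r = - cartan r s.
  rewrite vE addE scaleE !act_wpV !rho_notin ?mem_rev // !alE eqxx.
  by rewrite eq_sym (negPf sr) mulr1 addr0.
rewrite vr vE eulPr !IH // rpair_cons (cartan_sym s r); ring.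
Qed.

(* Serre duality E(x, c^-1 y) = - E(y, x) for the Coxeter element c = wp a * s
   and the simple root y = al s. *)
Lemma eul_serre a s x : uniq (s :: a) ->
  eul (rcons a s) x (refl s (act (wp a)^-1%g (al s))) =
  - eul (rcons a s) (al s) x.
Proof.
move=> usa; have /andP[sa ua] := usa; set z := act _ _.
have zs : z s = 1 by rewrite /z act_wpV rho_notin ?mem_rev // alE eqxx.
have sz : supp (s :: a) z.
  rewrite /z act_wpV; apply: supp_rho => [t|];
    first by rewrite mem_rev inE orbC => ->.
  exact/supp_al/mem_head.
rewrite !eul_rcons (@eq_eul a x x _ z (fun _ _ => erefl) (reflE_in _ sa))
  eul_coxeterV //.
rewrite (eq_rpair s (reflE_in _ sa)) (refl_diag usa sz) zs.
by rewrite (eul0l _ (al_in sa)) alE eqxx /=; ring.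
Qed.

(* The map pi_down for the acyclic orientation described by a, whose letters are
   listed in the order in which they occur in the Coxeter element: the first
   letter s is either taken, and then moved to the end of a, or dropped.  Each
   step lowers len w + size a by exactly 1, which makes this the exact amount of
   fuel in sort_rec and frame_rec. *)
Fixpoint sort_rec n (a : seq S) (w : W) : W :=
  if n is n'.+1 then
    if a is s :: a' then
      if ldesc s w then (gn s * sort_rec n' (rcons a' s) (gn s * w))%g
      else sort_rec n' a' w
    else 1%g
  else 1%g.
Definition csort a w := sort_rec (len w + size a) a w.

(* Each letter r of a is dropped once, after a product p of letters was taken;
   this puts the root p (al r), paired with its dual vector for the Euler form
   (frame_dual), in the frame.  The first components are the inward normals of a
   simplicial cone that contains the fiber of csort a through w. *)
Fixpoint frame_rec n (a : seq S) (w : W) : seq (V * V) :=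
  if n is n'.+1 then
    if a is s :: a' then
      if ldesc s w then
        [seq (refl s p.1, refl s p.2) | p <- frame_rec n' (rcons a' s) (gn s * w)%g]
      else (al s, al s) :: [seq (p.1, refl s p.2) | p <- frame_rec n' a' w]
    else [::]
  else [::].
Definition frame a w := frame_rec (len w + size a) a w.

(** * Unfolding, support and idempotence of sorting *)

Lemma csort_nil w : csort [::] w = 1%g.
Proof. by rewrite /csort addn0; case: len. Qed.
Lemma frame_nil w : frame [::] w = [::].
Proof. by rewrite /frame addn0; case: len. Qed.
Lemma csort_take s a w : ldesc s w ->
  csort (s :: a) w = (gn s * csort (rcons a s) (gn s * w))%g.
Proof.
move=> sw; rewrite /csort (len_ldesc sw) addSn /= sw; congr (_ * sort_rec _ _ _)%g.
by rewrite size_rcons.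
Qed.
Lemma csort_skip s a w : ~~ ldesc s w -> csort (s :: a) w = csort a w.
Proof. by move=> sw; rewrite /csort /= addnS /= (negPf sw). Qed.
Lemma frame_take s a w : ldesc s w -> frame (s :: a) w =
  [seq (refl s p.1, refl s p.2) | p <- frame (rcons a s) (gn s * w)%g].
Proof.
move=> sw; rewrite /frame (len_ldesc sw) addSn /= sw;
  congr [seq _ | _ <- frame_rec _ _ _].
by rewrite size_rcons.
Qed.
Lemma frame_skip s a w : ~~ ldesc s w -> frame (s :: a) w =
  (al s, al s) :: [seq (p.1, refl s p.2) | p <- frame a w].
Proof. by move=> sw; rewrite /frame /= addnS /= (negPf sw). Qed.

Lemma sort_ltn_ind (P : seq S -> W -> Prop) :
  (forall a w, (forall b v, (len v + size b < len w + size a)%N -> P b v) -> P a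
    w) ->
  forall a w, P a w.
Proof.
move=> h a w; move: {2}(len w + size a)%N (leqnn (len w + size a)%N) => n.
elim: n a w => [|n IH] a w la; apply: h => b v lb; first by lia.
by apply: IH; lia.
Qed.
Lemma sort_ind (P : seq S -> W -> Prop) :
  (forall w, P [::] w) ->
  (forall s a w, ldesc s w -> P (rcons a s) (gn s * w)%g -> P (s :: a) w) ->
  (forall s a w, ~~ ldesc s w -> P a w -> P (s :: a) w) ->
  forall a w, P a w.
Proof.
move=> h0 h1 h2; apply: sort_ltn_ind => -[|s a] w IH; first exact: h0.
have [sw|sw] := boolP (ldesc s w).
  by apply: h1 => //; apply: IH; rewrite (len_ldesc sw) size_rcons addSn ltnS.
by apply: h2 => //; apply: IH; rewrite /= addnS ltnS.
Qed.

Lemma csort_word a w : exists2 b, {subset b <= a} & csort a w = wp b.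
Proof.
move: a w; apply: sort_ind => [w|s a w sw [b ba bE]|s a w sw [b ba bE]].
- by exists [::]; rewrite ?csort_nil ?wp_nil.
- exists (s :: b); last by rewrite wp_cons -bE csort_take.
  by move=> t; rewrite !inE => /orP[->//|/ba]; rewrite mem_rcons inE.
- by exists b => [t /ba h|]; rewrite ?inE ?h ?orbT // csort_skip.
Qed.
Lemma nldesc_wp s (a b : seq S) : {subset b <= a} -> s \notin a -> ~~ ldesc s
  (wp b).
Proof.
move=> ba sa; rewrite ldescE; apply/negP => /posP /(_ s).
rewrite oppE act_wpV rho_notin; first by rewrite alE eqxx oppr_ge0 ler10.
by rewrite mem_rev; apply: contraNN sa; apply: ba.
Qed.
Lemma nldesc_csort s a w : s \notin a -> ~~ ldesc s (csort a w).
Proof. by have [b ba ->] := csort_word a w; apply: nldesc_wp. Qed.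

Lemma weak_le_nldesc s u w : weak_le C u w -> ~~ ldesc s w -> ~~ ldesc s u.
Proof. by move=> le_uw; apply: contraNN; apply: weak_le_ldesc. Qed.

Lemma csort_le a w : weak_le C (csort a w) w.
Proof.
move: a w; apply: sort_ind => [w|s a w sw IH|s a w sw IH].
- by rewrite csort_nil; apply: inv_weak_le => b /inv1.
- rewrite csort_take //; set z := csort _ _.
  have sz : ~~ ldesc s z by apply: (weak_le_nldesc IH); rewrite ldesc_gen negbK.
  have sgz : ldesc s (gn s * z)%g by rewrite ldesc_gen.
  by apply: (weak_le_gen2 sgz sw).1; rewrite genK.
- by rewrite csort_skip.
Qed.
Lemma ldesc_csort_take s a w : ldesc s w -> ~~ ldesc s (csort a (gn s * w)%g).
Proof. by move=> sw; apply: (weak_le_nldesc (csort_le _ _));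
  rewrite ldesc_gen negbK. Qed.

(** A letter r other than s is accepted for the output exactly when it was for w: the output starts
    with r in one case and lies below w in the other. The letter s is always refused, as the output
    is a word without s. *)
Lemma csort_idem s b w : let a := [seq t <- b | t != s] in
  csort b (csort a w) = csort a w.
Proof.
move: b w; apply: sort_ltn_ind => -[|r b] w IH /=; first by rewrite !csort_nil.
have [->|rs] /= := eqVneq r s.
  rewrite csort_skip ?IH //=; first by lia.
  by apply: nldesc_csort; rewrite mem_filter eqxx.
have [rw|rw] := boolP (ldesc r w).
  rewrite (csort_take _ rw) [LHS]csort_take ?ldesc_gen ?ldesc_csort_take // genK.
  have <- : [seq t <- rcons b r | t != s] = rcons [seq t <- b | t != s] r.
    by rewrite filter_rcons rs.
  by rewrite IH // (len_ldesc rw) size_rcons /=; lia.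
rewrite (csort_skip _ rw) csort_skip; last exact: (weak_le_nldesc (csort_le _ _)
  rw).
by apply: IH => /=; lia.
Qed.

(** * Projective classes and the frame *)

Lemma refl_pos_out s (x : V) : pos x -> x s = 0 -> pos (refl s x).
Proof.
move=> /posP px xs; apply/posP => t; rewrite reflE; case: eqP => [_|_];
  last by rewrite subr0.
rewrite addr_ge0 ?px // oppr_ge0 /pair; apply: sumr_le0 => i _.
have [->|si] := eqVneq i s; first by rewrite xs mulr0.
by rewrite mulr_le0_ge0 // cartan_le0 // eq_sym.
Qed.

(* eul a (proj a r) x = x r: in the representation theory of quivers these are
   the classes of the indecomposable projectives. *)
Fixpoint proj (a : seq S) (r : S) : V :=
  if a is s :: a' then if r == s then al s else refl s (proj a' r) else al r.

Lemma proj_rcons a s r : r \in a -> proj (rcons a s) r = proj a r.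
Proof.
elim: a => //= t a IH; rewrite inE; case: eqP => //= _ ra.
by rewrite IH.
Qed.
Lemma proj_rcons_last a s : s \notin a -> proj (rcons a s) s = rho a (al s).
Proof.
elim: a => /= [|t a IH]; first by rewrite eqxx.
by rewrite inE negb_or => /andP[/negPf -> /IH ->].
Qed.
Lemma proj_supp a r : r \in a -> supp a (proj a r).
Proof.
elim: a => //= s a IH; rewrite inE; case: eqP => [-> _|_ /= ra].
  exact/supp_al/mem_head.
apply: supp_refl; first exact: mem_head.
by apply: sub_supp (IH ra) => t ta; rewrite inE ta orbT.
Qed.
Lemma proj_pos a r : uniq a -> r \in a -> pos (proj a r) /\ proj a r r = 1.
Proof.
elim: a => //= s a IH /andP[sa ua]; rewrite inE;
  case: (eqVneq r s) => [-> _|rs /= ra].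
  by rewrite alE eqxx; split => //; apply: pos_al.
have [p1 p2] := IH ua ra; split; last by rewrite refl_neq.
by apply: refl_pos_out => //; apply: (proj_supp ra).
Qed.
Lemma proj_npos a r : uniq a -> r \in a -> ~ pos (- proj a r).
Proof.
move=> ua ra; have [_ p1] := proj_pos ua ra => /posP /(_ r).
by rewrite oppE p1 oppr_ge0 ler10.
Qed.

Lemma frame_root a w p : p \in frame a w -> root p.1 /\ root p.2.
Proof.
move: a w p; apply: sort_ind => [w p|s a w sw IH p|s a w sw IH p].
- by rewrite frame_nil.
- rewrite frame_take // => /mapP[q /IH[r1 r2] ->]; split; exact: root_refl.
- rewrite frame_skip // inE => /predU1P[->|/mapP[q /IH[r1 r2] ->]] /=.
    by split; apply: root_al.
  by split=> //; apply: root_refl.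
Qed.

Lemma frame_supp a w p : p \in frame a w -> supp a p.1 /\ supp a p.2.
Proof.
move: a w p; apply: sort_ind => [w p|s a w sw IH p|s a w sw IH p].
- by rewrite frame_nil.
- have sub : {subset rcons a s <= s :: a} by move=> t; rewrite mem_rcons.
  rewrite frame_take // => /mapP[q /IH[r1 r2] ->].
  by split; apply: supp_refl (mem_head _ _) (sub_supp sub _).
- have sub : {subset a <= s :: a} by move=> t ta; rewrite inE ta orbT.
  rewrite frame_skip // inE => /predU1P[->|/mapP[q /IH[r1 r2] ->]] /=.
    by split; apply/supp_al/mem_head.
  split; first exact: sub_supp r1.
  by apply: supp_refl (mem_head _ _) (sub_supp sub _).
Qed.

Lemma frame_pos a w p : p \in frame a w -> pos (act w^-1%g p.1).
Proof.
move: a w p; apply: sort_ind => [w p|s a w sw IH p|s a w sw IH p].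
- by rewrite frame_nil.
- by rewrite frame_take // => /mapP[q /IH h ->] /=; rewrite -actVM.
- rewrite frame_skip // inE => /predU1P[->|/mapP[q /IH h ->]] //=.
  exact: nondescent_pos.
Qed.

(** When s is dropped, [al s] as first argument of the Euler form reads off coordinate s, and
    reflecting the other dual vectors in s makes their form with [al s] vanish. When s is taken,
    everything is transported by [eul_refl]. *)
Lemma frame_dual a w x : uniq a -> supp a x ->
  x = \sum_(p <- frame a w) eul a p.2 x *: p.1.
Proof.
move: a w x; apply: sort_ind => [w x _ sx|s a w sw IH x ua sx|s a w sw IH x ua sx].
- rewrite frame_nil big_nil; apply/ffunP => t; rewrite sx //.
  by rewrite ffunE.
- have ua' : uniq (rcons a s) by rewrite rcons_uniq.
  have sub : {subset s :: a <= rcons a s} by move=> t; rewrite mem_rcons.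
  have sub' : {subset rcons a s <= s :: a} by move=> t; rewrite mem_rcons.
  have sx' : supp (rcons a s) (refl s x).
    by apply: supp_refl; [rewrite mem_rcons mem_head|apply: sub_supp sx].
  rewrite frame_take // big_map -[LHS](reflK s) {1}(IH _ ua' sx') linear_sum.
  apply: eq_big_seq => p pf /=; rewrite linearZ /=; congr (_ *: _).
  have [_ /(sub_supp sub') sp] := frame_supp pf.
  rewrite -{1}(reflK s p.2) eul_refl //; exact: supp_refl (mem_head _ _) sp.
- have /andP[sa ua'] : (s \notin a) && uniq a by [].
  pose y := x - x s *: al s.
  have xy : {in a, x =1 y}.
    move=> t ta; rewrite /y addE oppE scaleE alE.
    by rewrite (negPf (memPn sa t ta)) mulr0 subr0.
  have sy : supp a y.
    move=> t ta; rewrite /y addE oppE scaleE alE.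
    case: eqP => [->|/eqP ts]; first by rewrite mulr1 subrr.
    by rewrite mulr0 subr0 sx // inE negb_or ts.
  rewrite frame_skip // big_cons big_map /=.
  rewrite (rpair0 s (al_in sa)) (eul0l _ (al_in sa)) alE eqxx !addr0 mulr1.
  rewrite -[LHS](subrK (x s *: al s)) addrC -/y; congr (_ + _).
  rewrite {1}(IH y ua' sy); apply: eq_big_seq => p pf; congr (_ *: _).
  have [_ sp] := frame_supp pf.
  have sp' : supp (s :: a) p.2 by apply: sub_supp sp => t ta; rewrite inE ta orbT.
  rewrite (refl_diag _ sp') // (eq_rpair s (reflE_in _ sa)) (sp s sa).
  rewrite (eq_eul (reflE_in p.2 sa) xy).
  by rewrite oppr0 sub0r addNr mulr0 add0r.
Qed.

(* The letters of a taken before any letter comes back to the front. *)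
Fixpoint pass (a : seq S) (w : W) : seq S :=
  if a is s :: a' then
    if ldesc s w then s :: pass a' (gn s * w)%g else pass a' w
  else [::].

Lemma pass_len a w : len w = (size (pass a w) + len ((wp (pass a w))^-1 * w)%g)%N.
Proof.
elim: a w => [|s a IH] w /=; first by rewrite wp_nil invg1 mul1g.
case: ifP => // sw; rewrite (len_ldesc sw) (IH (gn s * w)%g) /= addSn.
by rewrite wp_cons invgM genV mulgA.
Qed.
Lemma pass_subseq a w : subseq (pass a w) a.
Proof.
elim: a w => [|s a IH] w //=; case: ifP => sw /=; first by rewrite eqxx.
exact: subseq_trans (IH w) (subseq_cons _ _).
Qed.
Lemma pass_csort a t w :
  csort (a ++ t) w = (wp (pass a w) * csort (t ++ pass a w) ((wp (pass a w))^-1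
    * w))%g.
Proof.
elim: a t w => [|s a IH] t w /=; first by rewrite wp_nil invg1 !mul1g cats0.
case: ifP => sw; last by rewrite csort_skip ?sw.
rewrite csort_take // -cats1 -catA IH wp_cons invgM genV !mulgA -catA.
by rewrite -!mulgA.
Qed.
(** Taken or dropped, each letter of a applies its reflection to the dual vector, so the pass can be
    undone letter by letter. A vector created by dropping r would lead to [- al r], whose coordinate
    at s is 0, unlike that of y. *)
Lemma pass_frame (a t : seq S) w p (y : V) s : s \notin a -> y s != 0 ->
  p \in frame (a ++ t) w -> p.2 = rho a y ->
  exists2 q, q \in frame (t ++ pass a w) ((wp (pass a w))^-1 * w)%g & q.2 = y.
Proof.
elim: a t w p => [|r a IH] t w p /=.
  by rewrite wp_nil invg1 mul1g cats0 => _ _ pf pE; exists p.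
rewrite inE negb_or => /andP[sr sa] ys.
have rhoI z : refl r z = rho (r :: a) y -> z = rho a y.
  by move=> /(congr1 (refl r)); rewrite reflK [RHS]reflK.
case: ifP => rw.
  rewrite frame_take // => /mapP[q qf -> /= /rhoI qE].
  move: qf; rewrite -cats1 -catA => qf.
  have [q' q'f q'E] := IH _ _ _ sa ys qf qE; exists q' => //.
  by rewrite wp_cons invgM genV -mulgA -catA in q'f *.
rewrite frame_skip ?rw // inE => /predU1P[-> /= h|/mapP[q qf -> /= /rhoI qE]].
  have {}h : - al r = rho a y by apply: rhoI; rewrite linearN /= refl_al opprK.
  move: ys; rewrite -(rho_notin y sa) -h oppE alE (negPf sr) oppr0.
  by rewrite eqxx.
exact: IH qf qE.
Qed.

(** As for two-term silting objects over a quiver, positive dual vectors play the role of modules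
    and negated [proj a r] that of shifted projectives; the third clause reflects the absence of
    extensions between the modules. The clauses feed each other in the induction. *)
Definition frame_spec a w :=
  [/\ forall p, p \in frame a w ->
        pos p.2 \/ exists2 r, r \in a & p.2 = - proj a r,
      forall b s p, a = rcons b s -> ~~ ldesc s w -> p \in frame a w ->
        p.2 <> - proj a s &
      forall p q, p \in frame a w -> q \in frame a w -> pos p.2 -> pos q.2 ->
        0 <= eul a p.2 q.2].

(* For the second clause: if - proj b t occurred for a last letter t, then t
   would be taken after the first pass, and Serre duality would express w^-1
   (al t) as a nonpositive combination of positive vectors, so t would be a
   descent of w. *)
Lemma frame_specP a w : uniq a -> frame_spec a w.
Proof.
move: a w; apply: sort_ltn_ind => -[|s a] w IH ua.
  by split=> [p|b s p|p q]; rewrite ?frame_nil //; case: b.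
have /andP[sa ua'] : (s \notin a) && uniq a by [].
have uas : uniq (rcons a s) by rewrite rcons_uniq.
split.
- have [sw|sw] := boolP (ldesc s w).
    have [|h1 h2 _] := IH (rcons a s) (gn s * w)%g _ uas.
      by rewrite (len_ldesc sw) size_rcons addSn ltnS.
    move=> p; rewrite frame_take // => /mapP[q qf ->] /=.
    have [_ rq] := frame_root qf.
    have [pq|[r ra qE]] := h1 q qf.
      have [->|qs] := eqVneq q.2 (al s).
        by right; exists s; rewrite ?mem_head ?refl_al ?eqxx.
      by left; apply: refl_pos.
    (* The second clause applies to the rotated word: its last letter s is not a descent of
       [gn s * w]. *)
    right; have rs : r != s.
      apply: contra_not_neq (h2 a s q erefl _ qf) => [rs|].
        by rewrite qE rs.
      by rewrite ldesc_gen negbK.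
    move: ra; rewrite mem_rcons inE (negPf rs) /= => ra.
    exists r; first by rewrite inE ra orbT.
    by rewrite qE proj_rcons // (negPf rs) linearN.
  have [|h1 _ _] := IH a w _ ua'; first by rewrite /= addnS ltnS.
  move=> p; rewrite frame_skip // inE => /predU1P[->|/mapP[q qf ->]] /=.
    by left; apply: pos_al.
  have [_ sq] := frame_supp qf.
  have [pq|[r ra qE]] := h1 q qf; first by left; apply: refl_pos_out => //;
    apply: sq.
  right; exists r; first by rewrite inE ra orbT.
  have /negPf -> : r != s by apply: contraNneq sa => <-.
  by rewrite qE linearN.
- move=> b t p aE tw pf pE; rewrite aE in pf pE ua IH.
  have /andP[tb ub] : (t \notin b) && uniq b by rewrite -rcons_uniq.
  have tal : (- al t) t != 0 by rewrite oppE alE eqxx oppr_eq0 oner_eq0.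
  rewrite proj_rcons_last // -linearN in pE; rewrite -cats1 in pf.
  have [q qf qE] := pass_frame tb tal pf pE.
  have lb := pass_len b w; have sb := pass_subseq b w.
  have ub1 := subseq_uniq sb ub.
  move: qf lb sb ub1; set c := pass b w; set v := (_ * w)%g => /= qf lb sb ub1.
  have tc : t \notin c by apply: contraNN tb; apply: mem_subseq.
  have utc : uniq (t :: c) by rewrite /= tc.
  have sc := size_subseq sb.
  have [tv|tv] := boolP (ldesc t v); last first.
    move: qf; rewrite frame_skip // inE => /predU1P[q1|/mapP[q' q'f q1]];
      move: qE; rewrite q1 /=.
      move=> /(congr1 (fun x : V => x t)); rewrite oppE !alE eqxx /=; lra.
    move=> /(congr1 (refl t)); rewrite reflK linearN /= refl_al opprK => q'E.
    have [_ /(_ t tc)] := frame_supp q'f; rewrite q'E alE eqxx => /eqP.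
    by rewrite oner_eq0.
  move: qf; rewrite frame_take // => /mapP[q' q'f q1]; move: qE; rewrite q1 /=.
  move=> /(congr1 (refl t)); rewrite reflK linearN /= refl_al opprK => q'E.
  have utc' : uniq (rcons c t) by rewrite rcons_uniq.
  set u := (gn t * v)%g in q'f.
  have tu : ~~ ldesc t u by rewrite ldesc_gen negbK.
  have [|h1 h2 h3] := IH (rcons c t) u _ utc'.
    move: sc lb; rewrite (len_ldesc tv) -/u !size_rcons.
    by move: (len u) (size c) (size b) (len w); clear; lia.
  (* y is al t moved by the inverse of the Coxeter element of [rcons c t], and u^-1 y = w^-1 (al t).
     Serre duality turns its frame coordinates into [- eul (rcons c t) (al t) x.2]. *)
  pose z := act (wp c)^-1%g (al t); pose y := refl t z.
  have sz : supp (rcons c t) y.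
    apply: supp_refl; first by rewrite mem_rcons mem_head.
    rewrite /z act_wpV; apply: supp_rho => [x|];
      first by rewrite mem_rev mem_rcons inE orbC => ->.
    by apply: supp_al; rewrite mem_rcons mem_head.
  have npy : pos (- act u^-1%g y).
    rewrite (frame_dual u utc' sz) linear_sum -sumrN big_seq;
      apply: pos_sum => x xf.
    rewrite linearZ -scaleNr; apply: posZ; last exact: frame_pos xf.
    rewrite eul_serre // opprK; have [px|[r ra xE]] := h1 x xf.
      (* Here it matters that al t is itself a dual vector, namely [q'.2]. *)
      by rewrite -q'E; apply: h3 => //; rewrite q'E pos_al.
    move: ra; rewrite mem_rcons inE => /predU1P[rt|ra].
      by case: (h2 c t x erefl tu xf); rewrite xE rt.
    rewrite xE eulNr proj_rcons // eul_rcons (eul0l _ (al_in tc)) alE eqxx.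
    have [pr _] := proj_pos ub1 ra; have sr := proj_supp ra.
    rewrite sr // !add0r mul1r oppr_ge0 /rpair big_seq; apply: sumr_le0 => i ic.
    rewrite mulr_le0_ge0 //; last by move/posP: pr => /(_ i).
    by apply: cartan_le0; apply: contraNneq tc => ->.
  case/negP: tw; rewrite ldescE.
  by move: npy; rewrite /u actVM reflK /v invgM invgK actM /z actKV.
- have [sw|sw] := boolP (ldesc s w).
    have [|h1 h2 h3] := IH (rcons a s) (gn s * w)%g _ uas.
      by rewrite (len_ldesc sw) size_rcons addSn ltnS.
    have key q : q \in frame (rcons a s) (gn s * w)%g -> pos (refl s q.2) -> pos
      q.2.
      move=> qf pq; have [//|[r ra qE]] := h1 q qf.
      have rs : r != s.
        apply: contra_not_neq (h2 a s q erefl _ qf) => [rs|].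
          by rewrite qE rs.
        by rewrite ldesc_gen negbK.
      move: ra; rewrite mem_rcons inE (negPf rs) /= => ra.
      case: (@proj_npos (s :: a) r ua); first by rewrite inE ra orbT.
      by move: pq; rewrite qE proj_rcons // linearN /= (negPf rs).
    have sub' : {subset rcons a s <= s :: a} by move=> t; rewrite mem_rcons.
    rewrite frame_take // => _ _ /mapP[p pf ->] /mapP[q qf ->] pp pq.
    have [_ /(sub_supp sub') sp] := frame_supp pf.
    have [_ /(sub_supp sub') sq] := frame_supp qf.
    rewrite -eul_refl //; try exact: supp_refl (mem_head _ _) _.
    by rewrite !reflK; apply: h3 => //; apply: key.
  have [|_ _ h3] := IH a w _ ua'; first by rewrite /= addnS ltnS.
  have fE q : q \in frame a w ->
      refl s q.2 s + rpair s a (refl s q.2) = 0 /\ (pos (refl s q.2) -> pos q.2).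
    move=> qf; have [_ sq] := frame_supp qf.
    have sq' : supp (s :: a) q.2 by apply: sub_supp sq => t ta; rewrite inE ta orbT.
    rewrite (refl_diag ua sq') (eq_rpair s (reflE_in _ sa)) (sq s sa); split.
      by rewrite oppr0 sub0r addNr.
    move=> /posP p2; apply/posP => t; have [->|ts] := eqVneq t s;
      first by rewrite sq.
    by rewrite -(refl_neq _ ts).
  rewrite frame_skip // => p q; rewrite !inE.
  case/predU1P=> [->|/mapP[p' pf ->]] /predU1P[->|/mapP[q' qf ->]] pp pq /=.
  + rewrite (rpair0 s (al_in sa)) (eul0l _ (al_in sa)) alE eqxx /=; lra.
  + rewrite (rpair0 s (al_in sa)) (eul0l _ (al_in sa)) alE eqxx !addr0 mulr1.
    by move/posP: pq => /(_ s).
  + by rewrite (fE _ pf).1 (eul0r_in _ (al_in sa)); lra.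
  + rewrite (fE _ pf).1 mulr0 add0r (eq_eul (reflE_in _ sa) (reflE_in _ sa)).
    by apply: h3 => //; apply: (fE _ _).2.
Qed.

(** * Walls of the cone that become simple roots *)

Lemma act_refl w s q x : act w (al s) = al q ->
  act w (refl s x) = refl q (act w x).
Proof.
move=> h; rewrite /refl actD actN actZ h; congr (_ - _ *: _).
by rewrite -!bil_al -h bil_act.
Qed.

(* Coordinate s of a vector of the dual frame is nonnegative when s is last
   and not a descent: the dual vector is a positive root, or the opposite of
   one not involving s. *)
Lemma frame_dual_last a s w p : uniq (rcons a s) -> ~~ ldesc s w ->
  p \in frame (rcons a s) w -> 0 <= p.2 s.
Proof.
move=> uas sw pf; have [h1 h2 _] := frame_specP w uas.
have /andP[sa ua] : (s \notin a) && uniq a by rewrite -rcons_uniq.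
have [/posP //|[r ra pE]] := h1 p pf.
move: ra; rewrite mem_rcons inE => /predU1P[rs|ra].
  by case: (h2 a s p erefl sw pf); rewrite pE rs.
by rewrite pE proj_rcons // oppE (proj_supp ra) // oppr0.
Qed.

Lemma wall_in_frame a s w q : uniq (rcons a s) -> ~~ ldesc s w ->
  act w^-1%g (al s) = al q -> exists2 p, p \in frame (rcons a s) w & p.1 = al s.
Proof.
move=> uas sw sq.
have /andP[sa ua] : (s \notin a) && uniq a by rewrite -rcons_uniq.
have sal : supp (rcons a s) (al s) by apply: supp_al; rewrite mem_rcons mem_head.
(* With s last, [al s] as second argument reads off coordinate s, so the coefficients of al s in the
   frame are those bounded by [frame_dual_last]. *)
have eulE x : eul (rcons a s) x (al s) = x s.
  rewrite eul_rcons (eul0r_in _ (al_in sa)) (rpair0 s (al_in sa)) alE eqxx.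
  by rewrite add0r addr0 mulr1.
have alsE : al s = \sum_(p <- frame (rcons a s) w) p.2 s *: p.1.
  by rewrite {1}(frame_dual w uas sal); apply: eq_bigr => p _; rewrite eulE.
have [/hasP[p pf p0]|/hasPn h] := boolP (has (fun p : V * V => p.2 s != 0)
  (frame (rcons a s) w)); last first.
  have := congr1 (fun x : V => x s) alsE; rewrite /= big_seq big1 => [|p /h
    /negPn /eqP ->].
    by rewrite alE eqxx ffunE => /eqP; rewrite oner_eq0.
  exact: scale0r.
exists p => //; apply: (@act_act_inj w^-1%g); rewrite sq.
have [rp _] := frame_root pf.
apply: root_supp => [||t tq]; [exact: root_act|exact: frame_pos pf|].
have qE : al q = \sum_(p <- frame (rcons a s) w) p.2 s *: act w^-1%g p.1.
  by rewrite -sq {1}alsE linear_sum; apply: eq_bigr => i _; rewrite linearZ.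
have := congr1 (fun x : V => x t) qE; rewrite /= alE (negPf tq) sum_ffunE big_seq.
move=> /esym /eqP; rewrite psumr_eq0 => [/allP /(_ p pf)|i fi].
  by rewrite pf scaleE mulf_eq0 (negPf p0) => /eqP.
rewrite scaleE mulr_ge0 ?(frame_dual_last uas sw fi) //.
by move/posP: (frame_pos fi).
Qed.

Lemma inv_supp (a b : seq S) g : {subset b <= a} -> inv (wp b) g -> supp a g.
Proof.
move=> ba [_ /posP p1 /posP p2] t ta; apply/eqP; rewrite eq_le p1 andbT.
have := p2 t; rewrite oppE act_wpV rho_notin ?oppr_ge0 // mem_rev.
by apply: contraNN ta; apply: ba.
Qed.
Lemma inv_csort_supp a w g : inv (csort a w) g -> supp a g.
Proof. by have [b ba ->] := csort_word a w; apply: inv_supp. Qed.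
Lemma inv_neq s z g : ~~ ldesc s z -> inv z g -> g != al s.
Proof. by move=> sz iz; apply: contraNneq sz => gE; apply: ldesc_inv;
  rewrite -gE. Qed.
Lemma inv_gen_refl s z g : ~~ ldesc s z -> inv z g -> inv (gn s * z)%g (refl s g).
Proof. by move=> sz iz; apply: inv_gen => //; apply: inv_neq iz. Qed.

Lemma fix_orthogonal s z : (forall g, inv z g -> pair s g = 0) ->
  act z^-1%g (al s) = al s.
Proof.
elim/weak_ind: z => [|t z tz IH] h; first by rewrite invg1 act1.
have st : cartan s t = 0 by rewrite -pair_al; apply/h/inv_al.
have tz' : ~~ ldesc t (gn t * z)%g by rewrite ldesc_gen negbK.
rewrite -{1}(genK t z) actVM /refl pair_al cartan_sym st scale0r subr0.
apply: IH => g ig; have := h (refl t g); rewrite -{1}(genK t z).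
move=> /(_ (inv_gen_refl tz' ig)).
by rewrite /refl pairB pairZ pair_al st mulr0 subr0.
Qed.

Lemma pair_le0 s (x : V) : pos x -> x s = 0 -> pair s x <= 0.
Proof.
move=> px xs; have /posP /(_ s) := refl_pos_out px xs.
by rewrite reflE eqxx xs sub0r oppr_ge0.
Qed.

(* When the letter r of the wall p.1 = p (al r) is dropped, the hypothesis forces
   al r to be orthogonal to everything csort still inverts. *)
Lemma frame_wall a w p : uniq a -> p \in frame a w ->
  (forall g, inv (csort a w) g -> eul a p.1 g <= eul a g p.1) ->
  exists q, act (csort a w)^-1%g p.1 = al q.
Proof.
move: a w p; apply: sort_ind => [w p _|s a w sw IH p ua|s a w sw IH p ua].
- by rewrite frame_nil.
- have uas : uniq (rcons a s) by rewrite rcons_uniq.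
  have sub : {subset rcons a s <= s :: a} by move=> t; rewrite mem_rcons.
  rewrite frame_take // csort_take // => /mapP[q qf ->].
  rewrite [(_, _).1]/=; set z := csort _ _ => h; rewrite actVM reflK.
  have sz : ~~ ldesc s z by apply: ldesc_csort_take.
  apply: IH => // g ig; have := h _ (inv_gen_refl sz ig).
  have [/(sub_supp sub) sq _] := frame_supp qf.
  have /(sub_supp sub) sg := inv_csort_supp ig.
  by rewrite !(=^~ @eul_refl s a) ?reflK //; apply: supp_refl (mem_head _ _) _.
- have /andP[sa ua'] : (s \notin a) && uniq a by [].
  have sub : {subset a <= s :: a} by move=> t ta; rewrite inE ta orbT.
  rewrite frame_skip // csort_skip // inE => /predU1P[->|/mapP[q qf ->]] /= h.
    exists s; apply: fix_orthogonal => g ig; have sg := inv_csort_supp ig.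
    have := h g ig; rewrite sg // alE eqxx mul0r mul1r !add0r.
    rewrite (eul0l _ (al_in sa)) (eul0r_in _ (al_in sa)) addr0.
    have pE := rpair_pair ua (sub_supp sub sg); rewrite sg // mulr0 add0r in pE.
    rewrite -pE => h0; apply/eqP; rewrite eq_le h0 andbT; apply: pair_le0;
      last exact: sg.
    by case: ig.
  apply: IH => // g ig; have := h g ig; have sg := inv_csort_supp ig.
  by have [sq _] := frame_supp qf; rewrite sg // sq // !mul0r !add0r.
Qed.

Lemma csort_wall a s w q : uniq (rcons a s) -> ~~ ldesc s w ->
  act w^-1%g (al s) = al q ->
  exists r, act (csort (rcons a s) w)^-1%g (al s) = al r.
Proof.
move=> uas sw sq; have [p pf pE] := wall_in_frame uas sw sq.
have /andP[sa ua] : (s \notin a) && uniq a by rewrite -rcons_uniq.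
rewrite -pE; apply: frame_wall => // g [_ /posP pg _]; rewrite pE.
(* With s last the two sides are [g s + rpair s a g] and [g s], and the Cartan entries in [rpair]
   are nonpositive. *)
rewrite !eul_rcons (eul0l _ (al_in sa)) (eul0r_in _ (al_in sa)) (rpair0 s (al_in
  sa)).
rewrite alE eqxx !add0r mul1r addr0 mulr1 gerDl /rpair big_seq;
  apply: sumr_le0 => t ta.
by rewrite mulr_le0_ge0 // cartan_le0 //; apply: contraNneq sa => ->.
Qed.

(** * Covers and monotonicity of sorting *)

Lemma act_conj x s v :
  act (x * gn s * x^-1)%g v = v - bil (act x (al s)) v *: act x (al s).
Proof.
rewrite !actM act_gen /refl actD actKV actN actZ -bil_al.
by rewrite -(bil_act x) actKV.
Qed.
Lemma act_inj u w : (forall x, act u x = act w x) -> u = w.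
Proof.
move=> h; apply: (@mulIg _ w^-1%g); rewrite mulgV; apply: faithful => x.
by rewrite actM h actKV.
Qed.
Lemma conj_eq x y s t : act x (al s) = act y (al t) \/ act x (al s) = - act y
  (al t) ->
  (x * gn s * x^-1 = y * gn t * y^-1)%g.
Proof.
case=> h; apply: act_inj => v; rewrite !act_conj h //.
by rewrite -(scaleN1r (act y (al t))) bilZl scalerA mulrAC mulrN1 opprK mul1r.
Qed.

Lemma len_gen1 s : len (gn s) = 1%N.
Proof. by have := odd_len_gen s; have := len_gen s; case: (len _) => [|[]]. Qed.

Lemma weak_le_step u w : weak_le C u w -> u != w ->
  exists r, [/\ weak_le C u (u * gn r)%g, weak_le C (u * gn r)%g w &
    len (u * gn r)%g = (len u).+1].
Proof.
rewrite /weak_le => luw uw; have [y1|[r ry]] := eq1_or_ldesc (u^-1 * w)%g.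
  by case/eqP: uw; apply: (@mulgI _ u^-1%g); rewrite mulVg y1.
have ly := len_ldesc ry; exists r.
have h1 := lenM (u * gn r)%g (gn r * (u^-1 * w))%g.
have h2 := lenM u (gn r).
rewrite -mulgA genK mulgA mulgV mul1g in h1.
rewrite mulgA mulVg mul1g invgM genV -mulgA len_gen1.
rewrite len_gen1 in h2.
have lE : len (u * gn r)%g = (len u).+1.
  by move: luw ly h1 h2; rewrite !mulgA; move: (len _) (len _) (len _) (len _)
    (len _); clear; lia.
by split; rewrite ?lE ?addn1 // addSnnS -ly.
Qed.

Lemma weak_le_gen s u w : ~~ ldesc s u -> ~~ ldesc s w -> weak_le C u w ->
  weak_le C (gn s * u)%g (gn s * w)%g.
Proof.
move=> su sw; rewrite -{1}(genK s u) -{1}(genK s w).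
by move/weak_le_gen2; apply; rewrite ldesc_gen.
Qed.

Theorem csort_mono a u w : uniq a -> weak_le C u w ->
  weak_le C (csort a u) (csort a w).
Proof.
move: a w u; apply: sort_ltn_ind => -[|s a] w IH u ua.
  by rewrite !csort_nil => _; apply: weak_le_refl.
have /andP[sa ua'] : (s \notin a) && uniq a by [].
have uas : uniq (rcons a s) by rewrite rcons_uniq.
move: {2}(len w - len u)%N (leqnn (len w - len u)) => k.
elim: k u => [|k IHk] u lk le_uw; have lu := weak_le_len le_uw;
  have [->|neq] := eqVneq u w; try exact: weak_le_refl.
  by have [r [_ /weak_le_len]] := weak_le_step le_uw neq; lia.
have [sw|sw] := boolP (ldesc s w); last first.
  rewrite !csort_skip //; last exact: weak_le_nldesc le_uw sw.
  by apply: IH => //=; rewrite addnS.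
have lsw := len_ldesc sw.
have IHs x : weak_le C x (gn s * w)%g ->
    weak_le C (csort (rcons a s) x) (csort (rcons a s) (gn s * w)%g).
  by apply: IH => //; rewrite lsw size_rcons addSn ltnS.
have [su|su] := boolP (ldesc s u).
  rewrite !csort_take //; apply: weak_le_gen; rewrite ?ldesc_csort_take //.
  exact/IHs/(weak_le_gen2 su sw).2.
(* It remains to treat a cover w = s u with s not a descent of u; there the image
   z of u under csort (rcons a s) dominates that of u under csort a, and its
   inversions are stable under s. *)
have [r [le1 le2 l1]] := weak_le_step le_uw neq.
have [wE|neq1] := eqVneq (u * gn r)%g w; last first.
  have [r' [_ /weak_le_len l2 l3]] := weak_le_step le2 neq1.
  apply: (@weak_le_trans _ (csort (s :: a) (u * gn r)%g)).
    by apply: IH => //=; lia.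
  by apply: IHk => //; lia.
(* Multiplying u by r on the right turns s into a descent, and al r is the only positive root made
   negative by r. *)
have sr : act u^-1%g (al s) = al r.
  have [//|ne] := eqVneq (act u^-1%g (al s)) (al r).
  have p := refl_pos (root_act _ (root_al s)) (nondescent_pos su) ne.
  move: sw; rewrite ldescE -wE invgM genV actM act_gen => n.
  by case: (root_asym (root_refl _ (root_act _ (root_al s))) p n).
have {wE} uE : u = (gn s * w)%g.
  suff -> : w = (gn s * u)%g by rewrite genK.
  rewrite -wE; apply: (@mulIg _ u^-1%g); rewrite -[RHS]mulgA mulgV.
  rewrite (@conj_eq u 1%g r s); first by rewrite invg1 mul1g.
  by left; rewrite act1 -sr actKV.
set v := csort (s :: a) u; have vE : v = csort a u by rewrite /v csort_skip.
have le_vu : weak_le C v u by apply: csort_le.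
have fE : [seq t <- rcons a s | t != s] = a.
  rewrite filter_rcons eqxx; apply/all_filterP/allP => t ta.
  exact: memPn sa t ta.
have idem : csort (rcons a s) v = v.
  by have := csort_idem s (rcons a s) u; rewrite /= fE vE.
have := IHs v; rewrite -uE idem => /(_ le_vu) le_vz.
rewrite csort_take // -uE; move: le_vz; set z := csort _ u => le_vz.
have [q zq] := csort_wall uas su sr; rewrite -/z in zq.
have sz : ~~ ldesc s z by apply: weak_le_nldesc (csort_le _ _) su.
have sv : ~~ ldesc s v by apply: weak_le_nldesc le_vz sz.
(* Since z^-1 (al s) = al q, one has s z = z q. An inversion b of z could only be lost if - z^-1 b
   were al q, that is, if b were the negative root - al s. *)
apply: inv_weak_le => b ib; have [rb pb nb] := weak_le_inv le_vz ib.
split => //; rewrite actVM (act_refl _ zq).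
set d := act z^-1%g b in nb *; have rd : root (- d) by apply/rootN/root_act.
rewrite -[X in refl _ X]opprK linearN /= opprK; apply: refl_pos => //.
apply/eqP => dE; have /eqP := congr1 (act z) dE;
  rewrite -zq actN /d !actKV => /eqP bE.
by apply: (root_asym (root_al s) (pos_al s)); rewrite -bE opprK.
Qed.

(** * Arbitrary orientations *)

Variable Omega : rel S.
Hypothesis hOmega : orientation C Omega.

Definition topo (a : seq S) : bool := uniq a && pairwise (fun x y => ~~ Omega x
  y) a.

Lemma topo_uniq a : topo a -> uniq a.
Proof. by case/andP. Qed.
Lemma topo_cons s a :
  topo (s :: a) = [&& s \notin a, all (fun y => ~~ Omega s y) a & topo a].
Proof. by rewrite /topo pairwise_cons /=; do !case: (_ \notin _) (all _ _) (uniq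
  _) => [] [] []. Qed.
Lemma topo_consP s a : topo (s :: a) ->
  [/\ s \notin a, forall y, y \in a -> ~~ Omega s y & topo a].
Proof. by rewrite topo_cons => /and3P[? /allP ? ?]. Qed.
Lemma topo_subseq a b : subseq a b -> topo b -> topo a.
Proof.
by move=> ab /andP[ub pb]; rewrite /topo (subseq_uniq ab) // (subseq_pairwise ab).
Qed.
Lemma topo_cat_notin a b x y : topo (a ++ b) -> x \in a -> y \in b -> ~~ Omega x y.
Proof.
by case/andP=> _; rewrite pairwise_cat => /and3P[/allrelP h _ _] xa yb; apply: h.
Qed.

Lemma Omega_irr s : Omega s s = false.
Proof. by apply/negP => /(hOmega.1) /andP[]; rewrite eqxx. Qed.
Lemma Omega_asym s t : Omega s t -> Omega t s -> False.
Proof. by move=> st ts; have := hOmega.2 _ _ (hOmega.1 _ _ st); rewrite st ts. Qed.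
Lemma Omega_comm s t : ~~ Omega s t -> ~~ Omega t s -> (gn s * gn t = gn t * gn
  s)%g.
Proof.
move=> st ts; have [->//|ne] := eqVneq s t; apply/eqP; apply: contraT => nc.
have := hOmega.2 s t; rewrite (negPf st) (negPf ts) /edge ne nc.
by move/(_ isT).
Qed.
Lemma Omega_cartan s t : Omega s t -> cartan s t <= -1.
Proof.
move=> /(hOmega.1) /andP[ne nc]; have [h|//] := cartan_gap ne.
case/eqP: nc; have m2 := cartan_eq0 ne h.
have := (gen_eq C [:: s; t; s; t] [::]).2.
rewrite -/(wp _) -/(wp [::]) !wp_cons wp_nil mulg1.
have h1 : cox_eq m [:: s; t; s; t] [::].
  by have := cox_eq_relator m [::] [::] s t; rewrite m2.
move=> /(_ h1) h2; have -> : (gn s * gn t = (gn s * gn t)^-1)%g.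
  by apply: (@mulgI _ (gn s * gn t)%g); rewrite mulgV -mulgA.
by rewrite invgM !genV.
Qed.

Lemma wp_comm_cat s b c : (forall x, x \in b -> gn s * gn x = gn x * gn s)%g ->
  wp (b ++ s :: c) = wp (s :: b ++ c).
Proof.
elim: b => //= x b IH h; rewrite wp_cons IH => [|y yb]; last by apply: h;
  rewrite inE yb orbT.
by rewrite !wp_cons !mulgA h ?mem_head.
Qed.

(** The first letter s of a commutes with everything before it in b: the order of a forbids edges
    from s to these letters, the order of b forbids edges from them to s. *)
Lemma topo_perm a b : topo a -> topo b -> a =i b -> wp a = wp b.
Proof.
elim: a b => [|s a IH] b ta tb ab.
  by case: b ab tb => // s b /(_ s); rewrite mem_head.
have sb : s \in b by rewrite -ab mem_head.
have [sa ha ta'] := topo_consP ta.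
case/splitPr: sb ab tb => b1 b2 ab tb.
have ub := topo_uniq tb.
have sb' : s \notin b1 ++ b2.
  by move: ub; rewrite -cat_rcons -cats1 -catA uniq_catCA /= => /andP[].
have sub : {subset b1 <= a}.
  move=> x xb; have : x \in s :: a by rewrite ab mem_cat xb.
  rewrite inE => /predU1P[xs|//]; case/negP: sb'.
  by rewrite -xs mem_cat xb.
rewrite wp_comm_cat => [|x xb]; last first.
  apply: Omega_comm; first exact/ha/sub.
  by apply: (topo_cat_notin tb xb); rewrite mem_head.
rewrite !wp_cons (IH (b1 ++ b2)) //.
  by apply: topo_subseq tb; rewrite subseq_cat2l // subseq_cons.
move=> x; have [->|xs] := eqVneq x s; first by rewrite (negPf sa) (negPf sb').
by have := ab x; rewrite mem_cat !inE (negPf xs) /= => ->; rewrite mem_cat.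
Qed.

Lemma topo_index a : uniq a ->
  topo a <-> {in a &, forall x y, Omega x y -> (index y a < index x a)%N}.
Proof.
elim: a => [|s a IH] //= /andP[sa ua]; rewrite topo_cons sa /=; split.
  case/andP=> /allP hs /(IH ua).1 h x y.
  rewrite !inE => /predU1P[->|xa] /predU1P[->|ya]; rewrite ?Omega_irr //.
  - by move/negP: (hs y ya).
  - by rewrite eqxx; case: eqP => // sx; rewrite sx xa in sa.
  - case: (s =P x) => [sx|_]; first by rewrite sx xa in sa.
    case: (s =P y) => [sy|_]; first by rewrite sy ya in sa.
    by rewrite ltnS; apply: h.
move=> h; apply/andP; split.
  apply/allP => y ya; apply/negP => sy.
  by have := h s y (mem_head _ _) _ sy; rewrite inE ya orbT eqxx => /(_ isT).
apply/(IH ua) => x y xa ya xy.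
have := h x y; rewrite !inE xa ya !orbT => /(_ isT isT xy).
case: (s =P x) => [sx|_]; first by rewrite sx xa in sa.
by case: (s =P y) => [sy|_ //]; rewrite sy ya in sa.
Qed.

Lemma c_orderingP (J : {set S}) a : c_ordering Omega J a <-> topo a /\ a =i J.
Proof.
split=> [[ua aJ h]|[ta aJ]]; first by split => //; apply/topo_index.
by have ua := topo_uniq ta; split => //; apply/(topo_index ua).
Qed.

Lemma c_ofE (J : {set S}) a : topo a -> a =i J -> c_of C Omega J = wp a.
Proof.
move=> ta aJ; rewrite /c_of.
have h : exists b, c_ordering Omega J b by exists a; apply/c_orderingP.
have /c_orderingP[tb bJ] := classical_sets.xgetPex [::] h.
by apply: topo_perm => // x; rewrite bJ aJ.
Qed.

Lemma topo_acyclic (J : {set S}) a : topo a -> a =i J -> acyclic Omega J.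
Proof.
move=> ta aJ p p0 pJ /andP[cp up].
have h := (topo_index (topo_uniq ta)).1 ta.
have descent n x : x \in p -> index x a = n -> False.
  elim/ltn_ind: n x => n IH x xp xn.
  have np : next p x \in p by rewrite mem_next.
  apply: (IH (index (next p x) a) _ (next p x) np erefl); rewrite -xn.
  by apply: h (next_cycle cp xp); rewrite aJ; apply: pJ.
by case: p p0 {pJ cp up} descent => // x p _ /(_ _ x (mem_head _ _) erefl).
Qed.

Lemma acyclic_topo (J : {set S}) : acyclic Omega J -> exists2 a, topo a & a =i J.
Proof.
move=> acJ; pose e x y := [&& x \in J, y \in J & Omega x y].
(* The number of letters reachable inside J drops strictly along an edge, since a way back would
   close a directed cycle. Increasing order puts targets before sources. *)
pose key x := #|connect e x|.
have key_lt x y : x \in J -> y \in J -> Omega x y -> (key y < key x)%N.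
  move=> xJ yJ xy; have exy : e x y by rewrite /e xJ yJ.
  apply/proper_card/properP; split.
    by apply/subsetP => z; apply: connect_trans; apply: connect1.
  exists x; first exact: connect0.
  apply/negP => /connectP[p /shortenP[q pq uq _] xE].
  have cq : cycle e (y :: q) by rewrite /= rcons_path pq -xE.
  apply: (acJ (y :: q)) => // [z zq|].
    by have /and3P[] := next_cycle cq zq.
  by rewrite /ucycle uq andbT; apply: sub_cycle cq => u v /and3P[].
exists (sort (fun x y => (key x <= key y)%N) (enum J)); last first.
  by move=> x; rewrite mem_sort mem_enum.
rewrite /topo sort_uniq enum_uniq /=.
have tr : transitive (fun x y => (key x <= key y)%N) by move=> y x z;
  apply: leq_trans.
have := @sort_sorted _ (fun x y => (key x <= key y)%N) (fun x y => leq_total _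
  _) (enum J).
rewrite (sorted_pairwise tr); apply: (@sub_in_pairwise _ (mem J)).
  move=> x y xJ yJ; rewrite leqNgt; apply: contraNN; exact: key_lt.
by apply/allP => x; rewrite mem_sort mem_enum.
Qed.

Lemma JcandidateP w (J : {set S}) : Jcandidate C Omega w J <->
  exists a, [/\ topo a, a =i J & weak_le C (wp a) w].
Proof.
split=> [[/acyclic_topo[a ta aJ]]|[a [ta aJ le_aw]]].
  by rewrite (c_ofE ta aJ) => h; exists a.
by split; [apply: topo_acyclic ta aJ|rewrite (c_ofE ta aJ)].
Qed.

(** * Products of distinct letters in the weak order *)

Lemma rho_al_pos b s : uniq b -> s \notin b -> pos (rho b (al s)).
Proof.
elim: b s => [|r b IH] s /=; first by move=> *; apply: pos_al.
case/andP=> rb ub; rewrite inE negb_or => /andP[sr sb].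
rewrite /rho /= -/(rho b _); apply: refl_pos_out; first exact: IH.
by rewrite rho_notin // alE eq_sym (negPf sr).
Qed.

Lemma inv_uniq b0 x b1 : uniq (b0 ++ x :: b1) ->
  inv (wp (b0 ++ x :: b1)) (rho b0 (al x)).
Proof.
rewrite cat_uniq => /and3P[ub0 hb /andP[xb1 ub1]].
split; first by rewrite -act_wp; exact/root_act/root_al.
  by apply: rho_al_pos => //; apply: contraNN hb => xb; apply/hasP; exists x;
    rewrite ?mem_head.
rewrite wp_cat wp_cons invgM actM -act_wp actK actVM refl_al actN opprK act_wpV.
by apply: rho_al_pos; rewrite ?rev_uniq ?mem_rev.
Qed.
Lemma ldesc_cons s b : uniq (s :: b) -> ldesc s (wp (s :: b)).
Proof. by move=> ub; apply: ldesc_inv; apply: (@inv_uniq [::]). Qed.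
Lemma len_uniq b : uniq b -> len (wp b) = size b.
Proof.
elim: b => [|s b IH] ub; first by rewrite wp_nil len1.
rewrite (len_ldesc (ldesc_cons ub)) wp_cons genK IH //.
by case/andP: ub.
Qed.
Lemma prefix_le b0 b1 : uniq (b0 ++ b1) -> weak_le C (wp b0) (wp (b0 ++ b1)).
Proof.
move=> ub; have := ub; rewrite cat_uniq => /and3P[u0 _ u1].
by rewrite /weak_le wp_cat mulgA mulVg mul1g -wp_cat !len_uniq // size_cat.
Qed.

(** Inversions of [wp a] have coordinate 0 at s, so reflecting one in s adds a nonnegative multiple
    of al s, which w also makes negative. *)
Lemma weak_le_skip s a w : s \notin a -> ldesc s w -> weak_le C (wp a) w ->
  weak_le C (wp a) (gn s * w)%g.
Proof.
move=> sa sw le_aw; apply: inv_weak_le => b ib.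
have sb : b s = 0 by apply: (inv_supp _ ib sa).
have [rb pb nb] := weak_le_inv le_aw ib; split => //.
have -> : - act (gn s * w)^-1%g b =
    - act w^-1%g b + (- pair s b) *: (- act w^-1%g (al s)).
  rewrite actVM /refl actD actN actZ opprD opprK.
  by rewrite scalerN scaleNr opprK.
apply: posD => //; apply: posZ; first by rewrite oppr_ge0 pair_le0.
by rewrite -ldescE.
Qed.

Lemma weak_le_cons s a w : uniq (s :: a) ->
  weak_le C (wp (s :: a)) w <-> ldesc s w /\ weak_le C (wp a) (gn s * w)%g.
Proof.
move=> ua; have sa := ldesc_cons ua.
split=> [h|[sw h]].
  have sw := weak_le_ldesc h sa; split => //.
  by have := (weak_le_gen2 sa sw).2 h; rewrite wp_cons genK.
by apply: (weak_le_gen2 sa sw).1; rewrite wp_cons genK.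
Qed.

Lemma inv_refl_sum s w b : inv w b -> ldesc s w -> pair s b <= 0 -> inv w (refl
  s b).
Proof.
move=> [rb pb nb] sw p0; split; first exact: root_refl.
  by apply: posD => //; rewrite -scaleNr; apply: posZ; rewrite ?oppr_ge0 ?pos_al.
have -> : - act w^-1%g (refl s b) =
    - act w^-1%g b + (- pair s b) *: (- act w^-1%g (al s)).
  rewrite /refl actD actN actZ opprD opprK.
  by rewrite scalerN scaleNr opprK.
by apply: posD => //; apply: posZ; rewrite ?oppr_ge0 -?ldescE.
Qed.

(* Otherwise b and b' would generate an infinite dihedral group, and w would
   invert the infinitely many roots in their cone. *)
Lemma inv_bil w b b' : inv w b -> inv w b' -> -2 < bil b b'.
Proof.
move=> ib ib'; rewrite ltNge; apply/negP.
elim/weak_ind: w b b' ib ib' => [|s w sw IH] b b' ib ib' h; first exact: (inv1 ib).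
(* If one of the roots is al s, which is lost in [gn s * w], the pair g, [refl s g] replaces it:
   both survive, and their product 2 - (pair s g)^2 is again at most -2. *)
have simple g : inv w g -> bil (al s) g <= -2 -> False.
  rewrite bil_al => ig hg.
  have gs : g != al s by apply/eqP => gE; move: hg;
    rewrite gE pair_al cartan_diag; lra.
  have irg : inv w (refl s g) by apply: inv_refl_sum => //; lra.
  have rgs : refl s g != al s.
    apply/eqP => gE; have [rg pg _] := ig.
    apply: (root_asym rg pg); rewrite -[g](reflK s) gE refl_al opprK; exact: pos_al.
  have := inv_gen irg rgs; rewrite reflK => ig'.
  apply: (IH _ _ ig' (inv_gen ig gs)); have [rg _ _] := ig.
  rewrite bilBr bilZr (root_norm rg) bilC bil_al; nra.
have [bE|bs] := eqVneq b (al s); first by apply: (simple b'); rewrite -?bE.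
have [bE|bs'] := eqVneq b' (al s); first by apply: (simple b); rewrite -?bE // bilC.
by apply: (IH _ _ (inv_gen ib bs) (inv_gen ib' bs')); rewrite bil_refl.
Qed.

(** * Adding a letter to a candidate *)

Definition gapped (z : R) := z = 0 \/ 1 <= z.
Lemma gapped_ge0 z : gapped z -> 0 <= z.
Proof. by case=> [->//|]; apply: le_trans. Qed.

Lemma gapped_term s t (v : V) : s != t -> gapped (v t) -> gapped (- (cartan s t
  * v t)).
Proof.
move=> st [->|v1]; first by left; rewrite mulr0 oppr0.
have [->|c1] := cartan_gap st; first by left; rewrite mul0r oppr0.
right; nra.
Qed.

(** As letters are distinct, the coordinate at r is set once, to a sum of terms
    [- cartan r i * v i], each 0 or at least 1. *)
Lemma rho_al_gap b x : uniq (rcons b x) -> forall t, gapped (rho b (al x) t).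
Proof.
elim: b => [|r b IH] /=.
  by move=> _ t; rewrite /rho /= alE; case: eqP => _; [right|left].
case/andP=> rb ub t; have {}IH := IH ub.
rewrite /rho /= -/(rho b _) reflE; case: eqP => [->|_]; last by rewrite subr0.
have vr : rho b (al x) r = 0.
  by move: rb; rewrite mem_rcons inE negb_or => /andP[rx rb];
    rewrite rho_notin // alE (negPf rx).
rewrite vr sub0r /pair -sumrN.
apply: (big_ind gapped) => [|y z [->|hy] [->|hz]|i _]; rewrite ?addr0 ?add0r;
  try by [left|right].
  by right; lra.
have [->|ir] := eqVneq i r; first by left; rewrite vr mulr0 oppr0.
by apply: gapped_term; rewrite 1?eq_sym.
Qed.

(** An edge from t to y puts y before t in the word, so the reflection in y acts when coordinate t
    is already at least 1, and coordinate y receives at least 1 from it. *)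
Lemma rho_al_closed b x y t : topo (rcons b x) -> y \in rcons b x ->
  rho b (al x) t != 0 -> Omega t y -> rho b (al x) y != 0.
Proof.
elim: b => [|r b IH].
  move=> _; rewrite inE => /eqP ->; rewrite /rho /= !alE eqxx.
  by rewrite oner_eq0.
move=> /topo_consP[rb hr tb]; rewrite rcons_cons inE => yrb.
rewrite /rho /= -/(rho b _); set v := rho b _ => vt ty.
have tr : t != r.
  apply: contraTneq ty => ->; case/predU1P: yrb => [->|/hr //].
  by rewrite Omega_irr.
have {}vt : v t != 0 by move: vt; rewrite refl_neq.
have [yE|yr] := eqVneq y r; last first.
  by rewrite refl_neq //; apply: IH => //; case/predU1P: yrb => // h;
    rewrite h eqxx in yr.
have vr : v r = 0.
  by move: rb; rewrite mem_rcons inE negb_or => /andP[rx rb];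
    rewrite /v rho_notin // alE (negPf rx).
rewrite yE reflE eqxx vr sub0r oppr_eq0 /pair (bigD1 t) //=.
have gap := rho_al_gap (topo_uniq tb).
have vt1 : 1 <= v t by case: (gap t) => // v0; rewrite -/v in v0;
  rewrite v0 eqxx in vt.
have c1 : cartan r t <= -1 by rewrite cartan_sym Omega_cartan // -yE.
rewrite lt_eqF //; apply: (@le_lt_trans _ _ (cartan r t * v t)); last by nra.
rewrite gerDl; apply: sumr_le0 => i _.
have [->|ir] := eqVneq i r; first by rewrite vr mulr0.
by rewrite mulr_le0_ge0 ?cartan_le0 1?eq_sym // gapped_ge0.
Qed.

Lemma topo_cat_out a1 y a2 x z : topo (a1 ++ y :: a2) ->
  x \in rcons a1 y -> Omega x z -> z \in a1 ++ y :: a2 -> z \in rcons a1 y.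
Proof.
rewrite -cat_rcons => ta xa xz; rewrite mem_cat => /orP[//|za].
by case/negP: (topo_cat_notin ta xa za).
Qed.
Lemma topo_rcons_out a y x : topo (rcons a y) -> x \in a -> ~~ Omega x y.
Proof. by rewrite -cats1 => ta xa; apply: (topo_cat_notin ta xa);
  rewrite mem_head. Qed.
Lemma topo_out_first a1 y a2 z : topo (a1 ++ y :: a2) ->
  Omega y z -> z \in a1 ++ y :: a2 -> z \in a1.
Proof.
move=> ta yz za; have := topo_cat_out ta _ yz za.
rewrite !mem_rcons mem_head inE => /(_ isT) /predU1P[zy|//].
by rewrite zy Omega_irr in yz.
Qed.

Lemma split_first (P : pred S) s : has P s ->
  exists s1 x s2, [/\ s = s1 ++ x :: s2, P x & ~~ has P s1].
Proof.
by case/split_find => x s1 s2 Px nP; exists s1, x, s2; rewrite cat_rcons.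
Qed.
Lemma rho_al_in b x t : rho b (al x) t != 0 -> t \in rcons b x.
Proof.
apply: contra_neqT; rewrite mem_rcons inE negb_or => /andP[tx tb].
by rewrite rho_notin // alE (negPf tx).
Qed.

(* A directed cycle through x would make the roots of the last letter x of
   rcons b x and of some letter of a, both inverted by w, too far apart. *)
Lemma extend_no_cycle a b x w : topo a -> topo (rcons b x) -> {subset b <= a} ->
  x \notin a -> weak_le C (wp a) w -> weak_le C (wp (rcons b x)) w ->
  (forall s, s \in a -> (forall y, y \in a -> ~~ Omega s y) -> Omega s x) ->
  forall y, y \in a -> ~~ Omega x y.
Proof.
move=> ta tb ba xa le_a le_b out y ya; apply/negP => xy.
have ub := topo_uniq tb.
pose v := rho b (al x).
have iv : inv w v by apply: (weak_le_inv le_b); rewrite -cats1;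
  apply: inv_uniq; rewrite cats1.
have xb : x \notin b by move: ub; rewrite rcons_uniq => /andP[].
have vx : v x = 1 by rewrite /v rho_notin // alE eqxx.
have vgap := rho_al_gap ub; rewrite -/v in vgap.
have v_in t : v t != 0 -> t \in rcons b x by apply: rho_al_in.
have v_out t : t \in a -> v t != 0 -> exists2 z, z \in a & Omega t z.
  move=> tia vt; have := v_in t vt; rewrite mem_rcons inE => /predU1P[tx|tib].
    by rewrite tx (negPf xa) in tia.
  have [/hasP[z za tz]|/hasPn h] := boolP (has (Omega t) a); first by exists z.
  by case/negP: (topo_rcons_out tb tib); apply: out.
(* Letters hit by an edge from the support of v. Taking the first such letter y1 of a keeps the
   supports of v and v' disjoint: a common letter would have an edge to an earlier letter of this
   kind. *)
pose Z y := has (fun t => (v t != 0) && Omega t y) (enum S).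
have ZI t z : v t != 0 -> Omega t z -> Z z.
  by move=> vt tz; apply/hasP; exists t; rewrite ?mem_enum ?vt.
have hZ : has Z a by apply/hasP; exists y => //; apply: (ZI x);
  rewrite // vx oner_neq0.
have [a1 [y1 [a2 [aE Zy1 nZ]]]] := split_first hZ.
have ua := topo_uniq ta.
rewrite {}aE in ta xa le_a out ya v_out ua hZ ba.
have y1a : y1 \in a1 ++ y1 :: a2 by rewrite mem_cat mem_head orbT.
have sub : {subset rcons a1 y1 <= a1 ++ y1 :: a2}.
  by move=> t; rewrite -cat_rcons mem_cat => ->.
have out1 t z : t \in rcons a1 y1 -> z \in a1 ++ y1 :: a2 -> Omega t z -> z \in a1.
  rewrite mem_rcons inE => /predU1P[->|t1] za tz; first exact: topo_out_first tz za.
  move: za; rewrite mem_cat => /orP[//|za].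
  by case/negP: (topo_cat_notin ta t1 za).
have disjoint t : t \in rcons a1 y1 -> v t = 0.
  move=> t1; apply/eqP; apply: contraT => vt.
  have [z za tz] := v_out t (sub t t1) vt.
  by move/hasPn: nZ => /(_ z (out1 _ _ t1 za tz)); rewrite (ZI t).
pose v' := rho a1 (al y1).
have t1 : topo (rcons a1 y1).
  by apply: topo_subseq ta; rewrite -cat_rcons prefix_subseq.
have u1 := topo_uniq t1.
have iv' : inv w v' by apply: (weak_le_inv le_a); apply: inv_uniq.
have v'gap := rho_al_gap u1; rewrite -/v' in v'gap.
have v'y1 : v' y1 = 1.
  by rewrite /v' rho_notin ?alE ?eqxx //; move: u1; rewrite rcons_uniq => /andP[].
have v'_in t : v' t != 0 -> t \in rcons a1 y1 by apply: rho_al_in.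
(* The first letter of a in the support of v' has no edge into a, by closedness of the support;
   [out] then supplies its edge to x. *)
have [s [v's sx]] : exists s, v' s != 0 /\ Omega s x.
  have hs : has (fun t => v' t != 0) (a1 ++ y1 :: a2).
    by apply/hasP; exists y1 => //; rewrite v'y1 oner_neq0.
  have [c1 [s [c2 [cE v's nc]]]] := split_first hs.
  exists s; split=> //; apply: out => [|z za].
    by rewrite cE mem_cat mem_head orbT.
  apply/negP => sz; have zc : z \in c1.
    by rewrite cE in ta za; apply: topo_out_first sz za.
  have z1 := out1 s z (v'_in s v's) za sz.
  have : v' z != 0 by apply: rho_al_closed sz => //; rewrite mem_rcons inE z1 orbT.
  by move/hasPn: nc => /(_ z zc) /negP.
have [y0 /andP[vy0 y01]] : exists y0, (v y0 != 0) && Omega y0 y1.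
  by case/hasP: Zy1 => t _ h; exists t.
have v_ge1 t : v t != 0 -> 1 <= v t by case: (vgap t) => // ->; rewrite eqxx.
have v'_ge1 t : v' t != 0 -> 1 <= v' t by case: (v'gap t) => // ->; rewrite eqxx.
have := inv_bil iv iv'; rewrite ltNge => /negP; apply.
have bilE : bil v v' = \sum_(p : S * S) v p.1 * (cartan p.1 p.2 * v' p.2).
  transitivity (\sum_t \sum_d v t * (cartan t d * v' d)); last by rewrite pair_bigA.
  by apply: eq_bigr => t _; rewrite /pair mulr_sumr.
have term_le0 t d : v t * (cartan t d * v' d) <= 0.
  have [->|vt] := eqVneq (v t) 0; first by rewrite mul0r.
  have [->|vd] := eqVneq (v' d) 0; first by rewrite !mulr0.
  have td : t != d by apply: contraNneq vt => ->; rewrite disjoint // v'_in.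
  rewrite pmulr_rle0 ?(lt_le_trans _ (v_ge1 _ vt)) // mulr_le0_ge0 ?cartan_le0 //.
  exact: le_trans (v'_ge1 _ vd).
have term_edge t d : v t != 0 -> v' d != 0 -> cartan t d <= -1 ->
    v t * (cartan t d * v' d) <= -1.
  move=> /v_ge1 h1 /v'_ge1 h2 h3.
  have h4 : cartan t d * v' d <= -1 by nra.
  by nra.
(* The edges y0 -> y1 and s -> x join the two supports in opposite directions, hence are different,
   and each contributes at most -1. *)
rewrite bilE (bigD1 (y0, y1)) //= (bigD1 (x, s)) /=; last first.
  rewrite xpair_eqE; apply/negP => /andP[/eqP xE /eqP sE].
  by apply: (Omega_asym sx); rewrite xE sE.
have e1 : v y0 * (cartan y0 y1 * v' y1) <= -1.
  by apply: term_edge; rewrite ?v'y1 ?oner_neq0 ?Omega_cartan.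
have e2 : v x * (cartan x s * v' s) <= -1.
  by apply: term_edge; rewrite ?vx ?oner_neq0 // cartan_sym; apply: Omega_cartan.
rewrite addrA -[- 2]addr0; apply: lerD; last by apply: sumr_le0 => -[t d] _.
have -> : - 2 = -1 - 1 :> R by ring.
exact: lerD.
Qed.

Lemma topo_swap s a b : topo a -> s \in a -> (forall y, y \in a -> ~~ Omega s y) ->
  b = rem s a -> [/\ topo (s :: b), a =i s :: b & wp a = wp (s :: b)].
Proof.
move=> ta sa hs ->.
have tb : topo (s :: rem s a).
  rewrite topo_cons mem_rem_uniqF ?(topo_uniq ta) //= (topo_subseq (rem_subseq s
    a) ta) andbT.
  by apply/allP => y /mem_rem; apply: hs.
have eqm : a =i s :: rem s a by apply: perm_mem; apply: perm_to_rem.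
by split => //; apply: topo_perm.
Qed.

(** A letter s of a without edges to a or x can be listed first everywhere and stripped from w. When
    no such letter exists, [extend_no_cycle] shows that x can be listed first. *)
Lemma topo_extend a b x w : topo a -> topo (rcons b x) -> {subset b <= a} ->
  x \notin a -> weak_le C (wp a) w -> weak_le C (wp (rcons b x)) w ->
  exists d, [/\ topo d, d =i x :: a & weak_le C (wp d) w].
Proof.
move: {2}(size a) (erefl (size a)) => n; elim: n a b w => [|n IH] a b w sza ta
  tb ba xa le_a le_b.
  move/size0nil: sza ba => -> ba; case: b ba tb le_b => [|y b] ba tb le_b.
    by exists [:: x].
  by have := ba y (mem_head _ _).
have xb : x \notin b by apply: contraNN xa; apply: ba.
have ub := topo_uniq tb.
have [/hasP[s sa /andP[/allP hs sx]]|/hasPn nosource] :=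
    boolP (has (fun s => all (fun y => ~~ Omega s y) a && ~~ Omega s x) a).
  have [ts sE wE] := topo_swap ta sa hs erefl.
  have us := topo_uniq ts; have xs : x != s by apply: contraNneq xa => ->.
  rewrite wE in le_a; have [sw le_a'] := (weak_le_cons _ us).1 le_a.
  have le_b' : weak_le C (wp (rcons (rem s b) x)) (gn s * w)%g.
    have [sb|sb] := boolP (s \in b); last first.
      rewrite rem_id //; apply: weak_le_skip => //.
      by rewrite mem_rcons inE negb_or eq_sym xs.
    have sbx : s \in rcons b x by rewrite mem_rcons inE sb orbT.
    have rE : rcons (rem s b) x = rem s (rcons b x).
      rewrite !rem_filter ?filter_rcons /= ?xs //; first by move: ub;
        rewrite rcons_uniq => /andP[].
    have [|ts' _ wE'] := topo_swap tb sbx _ rE.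
      by move=> y; rewrite mem_rcons inE => /predU1P[->//|/ba /hs].
    rewrite wE' in le_b; exact: ((weak_le_cons _ (topo_uniq ts')).1 le_b).2.
  have [|||||d [td dE le_d]] := IH (rem s a) (rem s b) (gn s * w)%g _ _ _ _ _
    le_a' le_b'.
  - by rewrite size_rem // sza.
  - exact: topo_subseq (rem_subseq _ _) ta.
  - apply: topo_subseq tb; rewrite -!cats1; apply: cat_subseq => //;
    exact: rem_subseq.
  - move=> y; rewrite !mem_rem_uniq ?(topo_uniq ta) //; last first.
      by move: ub; rewrite rcons_uniq => /andP[].
    by rewrite !inE => /andP[-> /ba].
  - by apply: contraNN xa; apply: mem_rem.
  have sd : s \notin d.
    by rewrite dE inE eq_sym (negPf xs) /= mem_rem_uniqF // topo_uniq.
  have tsd : topo (s :: d).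
    rewrite topo_cons sd td andbT /=; apply/allP => y.
    by rewrite dE inE => /predU1P[->//|/mem_rem]; apply: hs.
  exists (s :: d); split => //.
    by move=> y; rewrite inE dE !inE sE inE; case: (y == s); rewrite ?orbT.
  by apply/(weak_le_cons _ (topo_uniq tsd)).
have no_out : forall y, y \in a -> ~~ Omega x y.
  apply: (extend_no_cycle ta tb ba xa le_a le_b) => s sa hs.
  have := nosource s sa; rewrite negb_and negbK => /orP[/allPn[y ya]|//].
  by rewrite hs.
have txa : topo (x :: a) by rewrite topo_cons xa ta andbT; apply/allP.
exists (x :: a); split => //; apply/(weak_le_cons _ (topo_uniq txa)).
have xw : ldesc x w.
  have xbx : x \in rcons b x by rewrite mem_rcons mem_head.
  have [|ts' _ wE'] := topo_swap tb xbx _ erefl.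
    by move=> y; rewrite mem_rcons inE => /predU1P[->|/ba /no_out //];
      rewrite Omega_irr.
  rewrite wE' in le_b; exact: ((weak_le_cons _ (topo_uniq ts')).1 le_b).1.
by split => //; apply: weak_le_skip.
Qed.

(** * Unions of candidates and the maximal one *)

Lemma topo_union a b w : topo a -> topo b -> weak_le C (wp a) w -> weak_le C (wp
  b) w ->
  exists d, [/\ topo d, d =i a ++ b & weak_le C (wp d) w].
Proof.
move=> ta; elim/last_ind: b => [|b x IH] tb le_a le_b.
  by exists a; rewrite cats0.
have tb' : topo b by apply: topo_subseq (subseq_rcons _ _) tb.
have le_b' : weak_le C (wp b) w.
  by apply: weak_le_trans le_b; rewrite -cats1; apply: prefix_le;
    rewrite cats1 topo_uniq.
have [d [td dE le_d]] := IH tb' le_a le_b'.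
have [xd|xd] := boolP (x \in d).
  exists d; split => // y; rewrite dE !mem_cat mem_rcons inE.
  have [->|] //= := eqVneq y x; by rewrite -[LHS]mem_cat -dE xd orbT.
have [|d' [td' d'E le_d']] := topo_extend td tb _ xd le_d le_b.
  by move=> y yb; rewrite dE mem_cat yb orbT.
exists d'; split => // y; rewrite d'E inE dE !mem_cat mem_rcons inE.
by rewrite orbCA.
Qed.

Lemma topo_max w : exists a, [/\ topo a, weak_le C (wp a) w &
  forall b, topo b -> weak_le C (wp b) w -> {subset b <= a}].
Proof.
suff [a [ta le_a ha]] : exists a, [/\ topo a, weak_le C (wp a) w &
    forall J : {set S}, J \in enum {set S} ->
      forall b, topo b -> weak_le C (wp b) w -> b =i J -> {subset b <= a}].
  exists a; split=> // b tb le_b; apply: (ha [set x in b] _ b) => // [|x].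
    by rewrite mem_enum.
  by rewrite inE.
elim: (enum _) => [|J L [a [ta le_a ha]]].
  by exists [::]; split => //; rewrite wp_nil; apply: inv_weak_le => b /inv1.
have [[b [tb le_b bJ]]|nb] := pselect (exists b, [/\ topo b, weak_le C (wp b) w
  & b =i J]).
  have [d [td dE le_d]] := topo_union ta tb le_a le_b.
  exists d; split=> // K; rewrite inE => /predU1P[->|KL] c tc le_c cK x xc.
    by rewrite dE mem_cat bJ -cK xc orbT.
  by rewrite dE mem_cat (ha K KL c).
exists a; split=> // K; rewrite inE => /predU1P[->|KL] c tc le_c cK;
  last exact: (ha K).
by case: nb; exists c.
Qed.

Lemma Jmax_unique w a : topo a -> weak_le C (wp a) w ->
  (forall b, topo b -> weak_le C (wp b) w -> {subset b <= a}) -> a =i Jmax C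
    Omega w.
Proof.
move=> ta le_a max; pose J := [set x in a].
have aJ : a =i J by move=> x; rewrite inE.
have cJ : Jcandidate C Omega w J by apply/JcandidateP; exists a.
have sub K : Jcandidate C Omega w K -> K \subset J.
  by case/JcandidateP=> b [tb bK le_b]; apply/subsetP => x; rewrite -bK -aJ;
    apply: max.
have h : exists K : {set S}, Jcandidate C Omega w K /\
    forall K', Jcandidate C Omega w K' -> K \subset K' -> K' = K.
  exists J; split => // K' cK' JK'; apply/eqP; rewrite eqEsubset JK' andbT.
  exact: sub.
have [cM maxM] := classical_sets.xgetPex finset.set0 h.
move=> x; rewrite aJ /Jmax; congr (x \in pred_of_set _).
by apply: maxM => //; apply: sub.
Qed.

Lemma wp_pass_le a w : uniq a -> weak_le C (wp (pass a w)) w.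
Proof.
move=> ua; rewrite /weak_le len_uniq -?pass_len //.
exact: subseq_uniq (pass_subseq a w) ua.
Qed.
(** Greedy choice loses nothing: if s is a descent of w but not a letter of d, then [wp d] stays
    below [gn s * w]. *)
Lemma pass_max a d w : uniq a -> subseq d a -> weak_le C (wp d) w ->
  {subset d <= pass a w}.
Proof.
elim: a d w => [|s a IH] d w; first by move=> _ /eqP -> _ x.
case/andP=> sa ua; have [sd|sd] := boolP (s \in d).
  case: d sd => [//|t d] sd da.
  have ud : uniq (t :: d) by apply: subseq_uniq da _; rewrite /= sa.
  have ts : t = s.
    move: da => /=; case: eqP => // ne /mem_subseq /(_ _ sd).
    by rewrite (negPf sa).
  rewrite ts in da ud *; move/(weak_le_cons _ ud) => [sw le_d].
  rewrite /= sw => x; rewrite !inE; case: eqP => //= _ xd.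
  by apply: IH xd => //; move: da; rewrite /= eqxx.
have sub : subseq d (s :: a) -> subseq d a.
  case: d sd => [_ _|t d]; first exact: sub0seq.
  by rewrite inE negb_or eq_sym /= => /andP[/negPf ->].
move=> /sub da le_d /= x xd; case: ifP => sw; last exact: IH xd.
by rewrite inE (IH d) ?orbT //; apply: weak_le_skip.
Qed.
Lemma pass_id a w : uniq a -> weak_le C (wp a) w -> pass a w = a.
Proof.
elim: a w => [|s a IH] w //= ua /(weak_le_cons _ ua)[-> le_a].
by rewrite IH //; case/andP: ua.
Qed.
Lemma csort_pass a w : uniq a -> csort (pass a w) w = csort a w.
Proof.
move=> ua; have up := subseq_uniq (pass_subseq a w) ua.
have := pass_csort a [::] w; have := pass_csort (pass a w) [::] w.
by rewrite !cats0 !cat0s (pass_id up (wp_pass_le w ua)) => -> ->.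
Qed.

(** The word a need only contain the letters of every candidate for w. This is what allows one word
    to serve both w and the elements below it. *)
Lemma pass_Jmax a w : topo a ->
  (forall b, topo b -> weak_le C (wp b) w -> {subset b <= a}) ->
  topo (pass a w) /\ pass a w =i Jmax C Omega w.
Proof.
move=> ta sub; have ua := topo_uniq ta.
have tp := topo_subseq (pass_subseq a w) ta; split => //.
apply: Jmax_unique => // [|b tb le_b x xb]; first exact: wp_pass_le.
pose d := [seq y <- a | y \in b].
have da : subseq d a by apply: filter_subseq.
have db : d =i b.
  move=> y; rewrite mem_filter; case: (boolP (y \in b)) => //= yb.
  exact: (sub b tb le_b).
apply: (pass_max ua da); last by rewrite db.
by rewrite (topo_perm (topo_subseq da ta) tb db).
Qed.

Lemma Jmax_ordering w : exists a, [/\ topo a, a =i Jmax C Omega w,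
  weak_le C (wp a) w & forall b, topo b -> weak_le C (wp b) w -> {subset b <= a}].
Proof.
by have [a [ta le_a ha]] := topo_max w; exists a; split => //; apply: Jmax_unique.
Qed.

(** * Inversions as reflections, and parabolic parts *)

Lemma len_conj_inv w x s : inv w (act x (al s)) ->
  (len (x * gn s * x^-1 * w)%g < len w)%N.
Proof.
elim/weak_ind: w x s => [|r w rw IH] x s iw; first by case: (inv1 iw).
have [bE|br] := eqVneq (act x (al s)) (al r).
  rewrite (@conj_eq x 1%g s r); last by left; rewrite act1.
  by rewrite mul1g invg1 mulg1.
have := inv_gen iw br; rewrite -act_gen -actM => /IH h.
have lr := len_ldesc rw.
have h1 := lenM (gn r) (gn r * x * gn s * (gn r * x)^-1 * (gn r * w))%g.
have hE : (gn r * (gn r * x * gn s * (gn r * x)^-1 * (gn r * w)) = x * gn s *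
  x^-1 * w)%g.
  by rewrite invgM genV !mulgA gen_sq mul1g -!mulgA genK.
rewrite hE in h1; have g1 := len_gen r.
by apply: (leq_ltn_trans h1); rewrite lr ltnS;
  apply: (leq_trans (leq_add g1 (leqnn _))).
Qed.
Lemma conj_invol x s : (x * gn s * x^-1 * (x * gn s * x^-1) = 1)%g.
Proof. by rewrite -!mulgA mulKg genK mulgV. Qed.

(** A reflection determines its root only up to sign; comparing booleans covers both signs, and
    replacing x by [x * gn s] passes from one to the other. *)
Lemma len_conj w x s :
  (len (x * gn s * x^-1 * w)%g < len w)%N =
  (pos (act x (al s)) == pos (- act w^-1%g (act x (al s)))).
Proof.
suff pos_case y : pos (act y (al s)) ->
    (len (y * gn s * y^-1 * w)%g < len w)%N = pos (- act w^-1%g (act y (al s))).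
  have rb := root_act x (root_al s); have rw := root_act w^-1%g rb.
  have [p|p] := root_sign rb; first by rewrite p (pos_case x).
  have nE : - act x (al s) = act (x * gn s)%g (al s).
    by rewrite actM act_gen refl_al actN.
  have -> : (x * gn s * x^-1 = (x * gn s) * gn s * (x * gn s)^-1)%g.
    by apply: conj_eq; right; rewrite -nE opprK.
  rewrite pos_case -nE // actN opprK.
  have -> : pos (act x (al s)) = false.
    by apply/negP => p'; apply: (root_asym rb p' p).
  have [q|q] := root_sign rw; rewrite q.
    by case: (boolP (pos _)) => // q'; case: (root_asym rw q q').
  by case: (boolP (pos _)) => // q'; case: (root_asym rw q' q).
move=> p; have rb := root_act y (root_al s).
apply/idP/idP => [lt_len|n]; last by apply: len_conj_inv.
have [q|//] := root_sign (root_act w^-1%g rb).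
have : inv (y * gn s * y^-1 * w)%g (act y (al s)).
  split => //; rewrite invgM actM.
  have -> : act (y * gn s * y^-1)^-1%g (act y (al s)) = - act y (al s).
    rewrite !invgM invgK genV mulgA act_conj bil_act bil_al pair_al cartan_diag.
    by rewrite scaler_nat mulr2n opprD addNKr.
  by rewrite actN opprK.
move/len_conj_inv; rewrite mulgA conj_invol mul1g => h.
by have := ltn_trans h lt_len; rewrite ltnn.
Qed.

Lemma inv_conj_word p x s : inv (wp p) (act x (al s)) ->
  exists2 q, {subset q <= p} & (x * gn s * x^-1)%g = wp q.
Proof.
elim: p x => [|r p IH] x; first by rewrite wp_nil => /inv1.
rewrite wp_cons => ip; have [bE|br] := eqVneq (act x (al s)) (al r).
  exists [:: r]; first by move=> y; rewrite !inE => ->.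
  rewrite (@conj_eq x 1%g s r); last by left; rewrite act1.
  by rewrite mul1g invg1 mulg1 wp_seq1.
have := inv_gen ip br; rewrite genK -act_gen -actM => /IH [q qp qE].
exists (r :: rcons q r).
  move=> y; rewrite !inE mem_rcons inE => /or3P[->|->|/qp ->]; rewrite ?orbT //.
rewrite wp_cons wp_rcons -qE invgM genV !mulgA gen_sq mul1g.
by rewrite -!mulgA gen_sq mulg1.
Qed.

Lemma parabolic1 (J : {set S}) : parabolic C J 1%g.
Proof. by exists [::]; rewrite ?wp_nil. Qed.

Lemma parabolic_root (J : {set S}) x s : parabolic C J (x * gn s * x^-1)%g ->
  forall t, t \notin J -> act x (al s) t = 0.
Proof.
case=> p pJ pE t tJ; have tp : t \notin p by apply: contraNN tJ; apply: pJ.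
have := rho_notin (act x (al s)) tp; rewrite -act_wp -[wordprod C p]pE act_conj.
rewrite bil_act bil_al pair_al cartan_diag addE oppE scaleE; lra.
Qed.

Lemma inv_parabolic (J : {set S}) v x s : parabolic C J v ->
  (len (x * gn s * x^-1 * v)%g < len v)%N -> parabolic C J (x * gn s * x^-1)%g.
Proof.
case=> p pJ ->; rewrite len_conj => /eqP h.
have rb := root_act x (root_al s).
have sub q : {subset q <= p} -> {subset q <= J} by move=> qp y /qp /pJ.
have [pb|nb] := root_sign rb.
  have [|q qp qE] := @inv_conj_word p x s; last by exists q => //; apply: sub.
  by split => //; rewrite -h.
have nE : - act x (al s) = act (x * gn s)%g (al s).
  by rewrite actM act_gen refl_al actN.
have -> : (x * gn s * x^-1 = (x * gn s) * gn s * (x * gn s)^-1)%g.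
  by apply: conj_eq; right; rewrite -nE opprK.
have [|q qp qE] := @inv_conj_word p (x * gn s)%g s; last by exists q => //;
  apply: sub.
rewrite -nE; split => //; first exact: rootN.
rewrite actN opprK; have [//|q] := root_sign (root_act (wordprod C p)^-1%g rb).
by rewrite q in h; case: (root_asym rb h nb).
Qed.

Lemma parabolic_factor (J : {set S}) w : exists v y,
  [/\ w = (v * y)%g, parabolic C J v & forall s, s \in J -> ~~ ldesc s y].
Proof.
move: {2}(len w) (leqnn (len w)) => n; elim: n w => [|n IH] w lw.
  exists 1%g, w; split=> [||s _]; [by rewrite mul1g|exact: parabolic1|].
  by rewrite /ldesc; lia.
have [/existsP[s /andP[sJ sw]]|/existsPn h] := boolP [exists s, (s \in J) &&
  ldesc s w].
  have [|v [y [wE [p pJ vE] hy]]] := IH (gn s * w)%g.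
    by have := len_ldesc sw; lia.
  exists (gn s * v)%g, y; split => //; first by rewrite -mulgA -wE genK.
  exists (s :: p); last by rewrite [RHS]wp_cons vE.
  by move=> t; rewrite inE => /predU1P[->//|/pJ].
exists 1%g, w; split=> [||s sJ]; [by rewrite mul1g|exact: parabolic1|].
by have := h s; rewrite sJ.
Qed.

(** The factor v of w = v y serves as w_J: y^-1 keeps positive vectors supported on J positive, so
    roots supported on J have the same sign under v^-1 and w^-1. *)
Lemma par_part_spec (J : {set S}) w : parabolic C J (par_part C J w) /\
  inversions C (par_part C J w) = classical_sets.setI (inversions C w)
    (parabolic C J).
Proof.
apply: (@classical_sets.xgetPex _ 1%g (fun v => parabolic C J v /\
  inversions C v = classical_sets.setI (inversions C w) (parabolic C J))).
have [v [y [wE pv hy]]] := parabolic_factor J w.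
have sign b : root b -> (forall t, t \notin J -> b t = 0) ->
    pos (- act v^-1%g b) = pos (- act w^-1%g b).
  move=> rb bJ; rewrite wE invgM actM.
  have [p pJ vE] := pv.
  set c := act v^-1%g b.
  have cJ t : t \notin J -> c t = 0.
    move=> tJ; rewrite /c vE act_wpV rho_notin ?bJ // mem_rev.
    by apply: contraNN tJ; apply: pJ.
  have rc : root c by apply: root_act.
  have pos_y (z : V) : (forall t, t \notin J -> z t = 0) -> pos z -> pos (act
    y^-1%g z).
    move=> zJ pz; apply: pos_act => // t zt; apply: nondescent_pos; apply: hy.
    by apply: contraNT zt => /zJ ->.
  have ncJ t : t \notin J -> (- c) t = 0 by move=> tJ; rewrite oppE cJ // oppr0.
  apply/idP/idP => [n|n]; first by rewrite -actN; apply: pos_y.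
  have [pc|//] := root_sign rc.
  by case: (root_asym (root_act y^-1%g rc) (pos_y _ cJ pc) n).
exists v; split => //; apply/funext => t; apply/propext.
split=> [[[x [s ->]] lt_len]|[[[x [s ->]] lt_len] pt]].
  have pt := inv_parabolic pv lt_len.
  have tJ := parabolic_root pt.
  split=> //; split; first by exists x, s.
  by move: lt_len; rewrite !len_conj sign //; apply/root_act/root_al.
split; first by exists x, s.
have tJ := parabolic_root pt.
by move: lt_len; rewrite !len_conj sign //; apply/root_act/root_al.
Qed.

Lemma par_part_sign (J : {set S}) w x s : parabolic C J (x * gn s * x^-1)%g ->
  pos (- act (par_part C J w)^-1%g (act x (al s))) = pos (- act w^-1%g (act x
    (al s))).
Proof.
move=> pt; have [_ h] := par_part_spec J w.
have rt : reflection C (x * gn s * x^-1)%g by exists x, s.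
have {}h : (len (x * gn s * x^-1 * par_part C J w)%g < len (par_part C J w))%N =
           (len (x * gn s * x^-1 * w)%g < len w)%N.
  have e := congr1 (fun A => A (x * gn s * x^-1)%g) h.
  apply/idP/idP => [l1|l1].
    have : inversions C (par_part C J w) (x * gn s * x^-1)%g by split.
    by rewrite h => -[[]].
  have : classical_sets.setI (inversions C w) (parabolic C J) (x * gn s *
    x^-1)%g by split.
  by rewrite -h => -[].
by move: h; rewrite !len_conj; case: (pos (act x _)); case: (pos _); case: (pos _).
Qed.

Lemma par_part_le (J : {set S}) w : weak_le C (par_part C J w) w.
Proof.
apply: inv_weak_le => b [rb pb nb]; split => //.
case: rb pb nb => x [s ->] pb nb; have [pv _] := par_part_spec J w.
rewrite -(@par_part_sign J) //; apply: inv_parabolic pv _.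
by rewrite len_conj pb nb.
Qed.

Lemma le_par_part (J : {set S}) p w : {subset p <= J} -> weak_le C (wp p) w ->
  weak_le C (wp p) (par_part C J w).
Proof.
move=> pJ le_p; apply: inv_weak_le => b ib.
have [_ _ nw] := weak_le_inv le_p ib; have [rb pb _] := ib; split => //.
case: rb ib nw => x [s ->] ib nw; rewrite par_part_sign //.
have [q qp qE] := inv_conj_word ib; exists q => // t /qp; exact: pJ.
Qed.

(** * Computing [pi_down] by sorting *)

Lemma csort_agree a v w :
  (forall p t, {subset p <= a} -> t \in a -> ldesc t (wp p * v)%g = ldesc t (wp
    p * w)%g) ->
  csort a v = csort a w.
Proof.
move: a v w; apply: sort_ind => [v w _|s a v sv IH w h|s a v sv IH w h].
- by rewrite !csort_nil.
- have sw : ldesc s w.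
    by have := h [::] s; rewrite wp_nil !mul1g sv => <- //; rewrite mem_head.
  rewrite !csort_take //; congr (_ * _)%g; apply: IH => p t pa ta.
  rewrite !mulgA -!wp_rcons; apply: h; last by rewrite -mem_rcons.
  by move=> y; rewrite mem_rcons inE => /predU1P[->|/pa];
    rewrite ?mem_head // mem_rcons.
- have sw : ~~ ldesc s w.
    by have := h [::] s; rewrite wp_nil !mul1g (negPf sv) => <- //;
      rewrite mem_head.
  rewrite !csort_skip //; apply: IH => p t pa ta; apply: h;
    last by rewrite inE ta orbT.
  by move=> y /pa ya; rewrite inE ya orbT.
Qed.

Lemma par_part_ldesc (J : {set S}) w p t : {subset p <= J} -> t \in J ->
  ldesc t (wp p * par_part C J w)%g = ldesc t (wp p * w)%g.
Proof.
move=> pJ tJ; rewrite !ldescE !invgM !actM; apply: par_part_sign.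
rewrite invgK -wp_rev -wp_rcons -wp_cat; exists (rcons (rev p) t ++ p) => // y.
by rewrite mem_cat mem_rcons inE mem_rev => /orP[/predU1P[->//|/pJ]|/pJ].
Qed.

Lemma pi_nextE w a : topo a -> a =i Jmax C Omega w ->
  pi_next C Omega w = ((wp a)^-1 * par_part C (Jmax C Omega w) w)%g.
Proof. by move=> ta aJ; rewrite /pi_next (c_ofE ta aJ). Qed.

Lemma pi_next_len w : w != 1%g -> (len (pi_next C Omega w) < len w)%N.
Proof.
move=> w1; have [a [ta aJ le_a max]] := Jmax_ordering w.
have [wE|[s sw]] := eq1_or_ldesc w; first by rewrite wE eqxx in w1.
have sa : s \in a.
  apply: (max [:: s]); rewrite ?mem_head //; apply/(weak_le_cons _ (isT : uniq
    [:: s])).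
  by split=> //; rewrite wp_nil; apply: inv_weak_le => b /inv1.
rewrite (pi_nextE ta aJ).
have le_v : weak_le C (wp a) (par_part C (Jmax C Omega w) w).
  by apply: le_par_part => // x; rewrite aJ.
have h := weak_le_len (par_part_le (Jmax C Omega w) w).
apply: leq_trans h; rewrite -le_v len_uniq ?topo_uniq //.
by case: (a) sa => // x b _; rewrite addSn ltnS leq_addl.
Qed.

Lemma csort1 a : csort a 1%g = 1%g.
Proof.
elim: a => [|s a IH]; first by rewrite csort_nil.
by rewrite csort_skip // /ldesc len1.
Qed.

Lemma le_wp_subset (a q b : seq S) : {subset q <= a} -> uniq b -> weak_le C (wp
  b) (wp q) ->
  {subset b <= a}.
Proof.
move=> qa ub le_b x xb; apply: contraT => xa.
case/splitPr: xb ub le_b => b0 b1 ub le_b.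
have := inv_supp qa (weak_le_inv le_b (inv_uniq ub)) xa.
rewrite rho_notin; first by rewrite alE eqxx => /eqP; rewrite oner_eq0.
by move: ub; rewrite -cat_rcons cat_uniq rcons_uniq => /andP[/andP[]].
Qed.

Lemma pi_down_csort w a : topo a -> a =i Jmax C Omega w ->
  pi_down C Omega w = csort a w.
Proof.
move: {2}(len w) (leqnn (len w)) => n; elim/ltn_ind: n w a => n IH w a lw ta aJ.
have [->|w1] := eqVneq w 1%g; first by rewrite pi_down1 csort1.
have ua := topo_uniq ta.
have le_a : weak_le C (wp a) w.
  have [a' [ta' a'J le_a' _]] := Jmax_ordering w.
  by rewrite (topo_perm ta ta') // => x; rewrite aJ a'J.
rewrite (pi_downE pi_next_len w1) (c_ofE ta aJ).
have := pass_csort a [::] w; rewrite cats0 cat0s (pass_id ua le_a) => ->.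
congr (_ * _)%g; have lt_n := pi_next_len w1.
set w' := pi_next C Omega w in lt_n *.
have w'E := pi_nextE ta aJ; rewrite -/w' in w'E.
(* As w' lies in the parabolic subgroup of J(w, Omega), its candidates use only letters of a, so
   [pass a w'] lists the next maximal set. *)
have [q qa w'q] : exists2 q, {subset q <= a} & w' = wp q.
  have [[p pJ pE] _] := par_part_spec (Jmax C Omega w) w.
  exists (rev a ++ p); last by rewrite wp_cat wp_rev w'E pE.
  by move=> y; rewrite mem_cat mem_rev => /orP[//|/pJ]; rewrite aJ.
have [|tp pE] := @pass_Jmax a w' ta.
  by move=> b /topo_uniq ub; rewrite w'q; apply: le_wp_subset.
rewrite (IH (len w') _ w' (pass a w')) //; last exact: leq_trans lt_n lw.
(* Sorting along a only asks for descents in a of translates by words in a, and for those questions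
   w and its parabolic part agree. *)
rewrite csort_pass // w'E; apply: csort_agree => p t pa ta'.
rewrite !mulgA -wp_rev -wp_cat; apply: par_part_ldesc; last by rewrite -aJ.
by move=> y; rewrite mem_cat mem_rev -aJ => /orP[/pa|].
Qed.

Theorem pi_down_mono u w : weak_le C u w ->
  weak_le C (pi_down C Omega u) (pi_down C Omega w).
Proof.
move=> le_uw; have [a [ta aJ le_a max]] := Jmax_ordering w.
have ua := topo_uniq ta.
have [|tp pE] := @pass_Jmax a u ta.
  by move=> b tb le_b; apply: max => //; apply: weak_le_trans le_b le_uw.
rewrite (pi_down_csort ta aJ) (pi_down_csort tp pE) csort_pass //.
exact: csort_mono.
Qed.

End ReflectionRepresentation.

(** * Cosines as Chebyshev constants *)

Local Notation Real := Rdefinitions.R.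

Lemma cheb_sin (x : Real) k : cheb (2 * cos x) k * sin x = sin (x *+ k).
Proof.
elim/ltn_ind: k => -[|[|k]] IH.
- by rewrite /= mul0r mulr0n -R0E sin_0.
- by rewrite /= mul1r.
rewrite chebSS mulrBl -mulrA !IH //.
have -> : x *+ k.+2 = x *+ k.+1 + x by rewrite mulrSr.
have -> : x *+ k = x *+ k.+1 - x by rewrite mulrSr addrK.
have := sin_plus (x *+ k.+1) x; have := sin_minus (x *+ k.+1) x.
rewrite RplusE !RminusE RplusE !RmultE => -> ->.
by ring.
Qed.

Lemma cox_constants_cos :
  cox_constants (fun n => if n is 0 then 2 else 2 * cos (PI / n%:R) : Real).
Proof.
split=> // -[|n] // n1; set x : Real := PI / n.+1%:R.
have xn : x *+ n.+1 = PI.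
  by rewrite /x -[_ *+ _]mulr_natr mulrVK ?unitfE ?pnatr_eq0.
have x0 : 0 < x.
  by rewrite /x divr_gt0 ?ltr0n //; apply/RltP; exact: PI_RGT_0.
have sin_pos k : (0 < k < n.+1)%N -> 0 < sin (x *+ k).
  case/andP=> k0 kn; apply/RltP; apply: sin_gt_0; apply/RltP.
    by rewrite pmulrn_lgt0.
  by rewrite -xn ltr_pMn2l.
have s1 : 0 < sin x by have := sin_pos 1%N; rewrite mulr1n; apply; lia.
split=> [|k /sin_pos]; last by rewrite -cheb_sin pmulr_lgt0.
by apply: (mulIf (lt0r_neq0 s1)); rewrite cheb_sin xn sin_PI mul0r.
Qed.

Theorem theorem1p2 (W : groupType) (S : finType) (C : coxeter_system W S)
    (Omega : rel S) (hOmega : orientation C Omega) (u w : W) :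
  weak_le C u w -> weak_le C (pi_down C Omega u) (pi_down C Omega w).
Proof. exact: (pi_down_mono cox_constants_cos hOmega). Qed.
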